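(* Let $D$ be a unique factorization domain with quotient field $K$, and let $\operatorname{Int}(D)=\{f\in K[X]\mid f(D)\subseteq D\}$. Exactly one of the following holds: (1) $\operatorname{Int}(D)=D[X]$ is a unique factorization domain. (2) $\operatorname{Int}(D)$ has full system of multisets of lengths, i.e., for all positive integers $k$ and all integers $1<n_1\leq\ldots\leq n_k$ there exists an integer-valued polynomial $H\in\operatorname{Int}(D)$ which has precisely $k$ essentially different factorizations into irreducible elements of $\operatorname{Int}(D)$, and the lengths of these $k$ factorizations are exactly $n_1,\ldots,n_k$ (counted with multiplicity). Moreover, (1) holds if and only if the residue field of each height-one prime ideal of $D$ is infinite.
   Context: For an integral domain $R$, a non-zero non-unit is irreducible if it cannot be written as a product of two non-units of $R$. A factorization of $r\in R$ is a decomposition $r=a_1\cdots a_n$ into irreducible elements $a_i$ of $R$; $n$ is its length. Two elements $r,s\in R$ are associated if $r=\varepsilon s$ for some unit $\varepsilon\in R$. Two factorizations $r=a_1\cdots a_n=u_1\cdots u_m$ are essentially the same if $n=m$ and, after re-indexing if necessary, $u_i$ is associated to $a_i$ for all $i$; otherwise they are essentially different. The residue field of a prime ideal $P$ of $D$ is the quotient field of $D/P$ (it is infinite if and only if $D/P$ is infinite). *)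

(* Defs.v *)
From HB Require Import structures.
From mathcomp Require Import all_boot all_order all_algebra.
From mathcomp Require Import ring_quotient fraction.
From mathcomp Require Import boolp classical_sets functions cardinality.

Set Implicit Arguments.
Unset Strict Implicit.
Unset Printing Implicit Defensive.

Import GRing.Theory.

Local Open Scope classical_set_scope.
Local Open Scope ring_scope.

Section Factorizations.
Variable R : idomainType.

Definition irreducible_elt (r : R) : Prop :=
  [/\ r != 0, r \isn't a GRing.unit
    & forall a b : R, r = a * b -> a \is a GRing.unit \/ b \is a GRing.unit].

(* The length of a factorization is its [size]. The empty list only factors 1. *)
Definition factorization (r : R) (s : seq R) : Prop :=
  (forall a, a \in s -> irreducible_elt a) /\ r = \prod_(a <- s) a.

Definition associated (r s : R) : Prop :=
  exists2 e : R, e \is a GRing.unit & r = e * s.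

Definition essentially_same (s t : seq R) : Prop :=
  size s = size t /\
  exists2 t' : seq R, perm_eq t' t
    & forall i, (i < size s)%N -> associated (nth 0 t' i) (nth 0 s i).

Definition is_ufd : Prop :=
  forall r : R, r != 0 -> r \isn't a GRing.unit ->
    (exists s, factorization r s) /\
    (forall s t, factorization r s -> factorization r t -> essentially_same s t).

Definition full_system_of_multisets_of_lengths : Prop :=
  forall (k : nat) (n : 'I_k -> nat),
    (0 < k)%N -> (forall i, (1 < n i)%N) ->
    (forall i j : 'I_k, (i <= j)%N -> (n i <= n j)%N) ->
    exists (H : R) (s : 'I_k -> seq R),
      [/\ forall i, factorization H (s i),
          forall i, size (s i) = n i,
          forall i j, i != j -> ~ essentially_same (s i) (s j)
        & forall t, factorization H t -> exists i, essentially_same t (s i)].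

End Factorizations.

(* [idomainType] carries a boolean unit predicate and a total inverse; here
   they are supplied classically for a commutative ring without zero divisors. *)
Section ClassicalIdomain.
Variables (R : comNzRingType) (R_integral : GRing.integral_domain_axiom R).

Definition classical_idomain of GRing.integral_domain_axiom R : Type := R.
Local Notation A := (classical_idomain R_integral).

HB.instance Definition _ := GRing.ComNzRing.on A.

Definition cl_unit : {pred A} := fun x => `[< exists y : A, y * x = 1 >].
Definition cl_inv (x : A) : A :=
  if pselect (exists y : A, y * x = 1) is left e
  then projT1 (cid e) else x.

Fact cl_mulVx : {in cl_unit, left_inverse 1 cl_inv *%R}.
Proof.
move=> x /asboolP ux; rewrite /cl_inv.
by case: pselect => // e; case: cid.
Qed.

Fact cl_unitPl (x y : A) : y * x = 1 -> cl_unit x.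
Proof. by move=> yx; apply/asboolP; exists y. Qed.

Fact cl_inv_out : {in [predC cl_unit], cl_inv =1 id}.
Proof.
move=> x /asboolP nux; rewrite /cl_inv.
by case: pselect => // ux; case: nux.
Qed.

HB.instance Definition _ :=
  GRing.ComNzRing_hasMulInverse.Build A cl_mulVx cl_unitPl cl_inv_out.
HB.instance Definition _ := GRing.ComUnitRing_isIntegral.Build A R_integral.

End ClassicalIdomain.

Section IntegerValuedPolynomials.
Variable D : idomainType.
Local Notation K := {fraction D}.
Local Notation tofrac := (@FracField.tofrac D).

Definition Int_set : set {poly K} :=
  [set f | forall a : D, exists b : D, f.[tofrac a] = tofrac b].

Definition Int_pred : {pred {poly K}} := fun f => `[< Int_set f >].

Record Int_ring := MkInt { Int_val :> {poly K}; _ : Int_pred Int_val }.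

HB.instance Definition _ := [isSub for Int_val].
HB.instance Definition _ := [Choice of Int_ring by <:].

Fact Int_subring_closed : subring_closed Int_pred.
Proof.
split.
- by apply/asboolP => a; exists 1; rewrite hornerC rmorph1.
- move=> f g /asboolP Df /asboolP Dg; apply/asboolP => a.
  have [b Hb] := Df a; have [c Hc] := Dg a.
  by exists (b - c); rewrite hornerD hornerN Hb Hc rmorphB.
- move=> f g /asboolP Df /asboolP Dg; apply/asboolP => a.
  have [b Hb] := Df a; have [c Hc] := Dg a.
  by exists (b * c); rewrite hornerM Hb Hc rmorphM.
Qed.

HB.instance Definition _ :=
  GRing.SubChoice_isSubComNzRing.Build {poly K} Int_pred Int_ring
    Int_subring_closed.

Fact Int_integral : GRing.integral_domain_axiom Int_ring.
Proof.
move=> f g fg0; have /eqP : val f * val g = 0 by rewrite -rmorphM fg0 rmorph0.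
by rewrite mulf_eq0 => /orP[] /eqP h; apply/orP; [left | right];
  apply/eqP/val_inj; rewrite rmorph0.
Qed.

Definition Int : idomainType := classical_idomain Int_integral.

(* D[X], viewed inside K[X] *)
Definition polys_over_base : set {poly K} := range (map_poly tofrac).

End IntegerValuedPolynomials.

Arguments Int_set : clear implicits.
Arguments polys_over_base : clear implicits.

Section PrimeIdeals.
Variable D : idomainType.

Definition strict_subideal (P Q : prime_idealr D) : Prop :=
  {subset (P : {pred D}) <= (Q : {pred D})} /\
  exists2 x, x \in (Q : {pred D}) & x \notin (P : {pred D}).

(* a strict chain c 0 < c 1 < ... < c n = P of prime ideals; values of c beyond
   n are irrelevant *)
Definition prime_chain (n : nat) (P : prime_idealr D) : Prop :=
  exists c : nat -> prime_idealr D,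
    (forall i, (i < n)%N -> strict_subideal (c i) (c i.+1)) /\
    (c n : {pred D}) =i (P : {pred D}).

Definition has_height (P : prime_idealr D) (h : nat) : Prop :=
  prime_chain h P /\ forall n, prime_chain n P -> (n <= h)%N.

Definition residue_domain (P : prime_idealr D) : idomainType :=
  classical_idomain (@Quotient.rquot_IdomainAxiom D P).

Definition residue_field (P : prime_idealr D) : fieldType :=
  {fraction (residue_domain P)}.

End PrimeIdeals.

(* Main.v *)
(** If every height-one prime has infinite residue field, a polynomial whose
    values are all divisible by a prime of [D] has all its coefficients
    divisible by it, so denominators cancel, and [D[X]] is factorial by Gauss.

    Otherwise let [p] be a prime of [D] with [D/(p)] finite.  Take
    [Q0 = X^n0 - p^N] and [Q_j = (1 - u_j X)^(n_j) - p^(w_j) X] with [n0]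
    coprime to [N] and [n_j] to [w_j]: by the Newton polygon they are
    irreducible over [K], and [Q_j] has [p]-adic value [w_j] on the residue
    class [1/u_j] and [0] elsewhere.  Put [H = Q0 * prod_j Q_j / p^N].  Since
    [H(0)] is a unit of [D], every divisor of [H] takes a unit value at [0];
    hence the whole denominator [p^N] stays with [Q0], and the factorizations
    of [H] are [(Q0 * prod_(j in I) Q_j / p^N) * prod_(j notin I) Q_j] for [I]
    minimal such that the first factor is integer-valued.  This last condition
    only says that on each nonzero residue class the weights [w_j], [j in I],
    add up to at least [N].  On all classes but one every [Q_j] is needed; on
    the remaining class the complements of the minimal [I] are the maximal
    packings of a knapsack, with weights chosen so that there are exactly [k]
    of them, of sizes [n_1 - 1, ..., n_k - 1]. *)
From HB Require Import structures.
Require Import Defs.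
From mathcomp Require Import all_boot all_order all_algebra.
From mathcomp Require Import ring_quotient fraction.
From mathcomp Require Import boolp classical_sets functions cardinality.
From mathcomp Require Import zify ring.

Set Implicit Arguments.
Unset Strict Implicit.
Unset Printing Implicit Defensive.

Import GRing.Theory.

Local Open Scope ring_scope.

(** * Divisibility and factoriality *)

Section Divisibility.
Variable R : idomainType.
Implicit Types (a b c p x y : R) (s t : seq R).

Definition divides a b : Prop := exists c, b = a * c.

Definition prime_elt p : Prop :=
  [/\ p != 0, p \isn't a GRing.unit
    & forall a b, divides p (a * b) -> divides p a \/ divides p b].

Lemma divides_mull a b c : divides a b -> divides a (c * b).
Proof. by case=> d ->; exists (c * d); rewrite mulrCA. Qed.

Lemma divides_mulr a b c : divides a b -> divides a (b * c).
Proof. by rewrite mulrC; apply: divides_mull. Qed.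

Lemma divides_add a b c : divides a b -> divides a c -> divides a (b + c).
Proof. by case=> d -> [e ->]; exists (d + e); rewrite mulrDr. Qed.

Lemma divides_sub a b c : divides a b -> divides a c -> divides a (b - c).
Proof. by case=> d -> [e ->]; exists (d - e); rewrite mulrBr. Qed.

Lemma divides0 a : divides a 0.
Proof. by exists 0; rewrite mulr0. Qed.

Lemma dividesxx a : divides a a.
Proof. by exists 1; rewrite mulr1. Qed.

Lemma divides_trans b a c : divides a b -> divides b c -> divides a c.
Proof. by case=> d -> [e ->]; exists (d * e); rewrite mulrA. Qed.

Lemma divides_unit a u : u \is a GRing.unit -> divides a u ->
  a \is a GRing.unit.
Proof. by move=> + [c uE]; rewrite uE unitrM => /andP[]. Qed.

Lemma divides_sum (I : Type) (r : seq I) (P : pred I) (F : I -> R) a :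
  (forall i, P i -> divides a (F i)) -> divides a (\sum_(i <- r | P i) F i).
Proof.
move=> aF; elim/big_rec: _ => [|i x Pi ax]; first exact: divides0.
by apply: divides_add => //; apply: aF.
Qed.

Lemma divides_prod_mem x s : x \in s -> divides x (\prod_(y <- s) y).
Proof.
by move=> xs; rewrite (big_rem x) //=; apply/divides_mulr/dividesxx.
Qed.

Lemma prime_divides_prod p s : prime_elt p -> divides p (\prod_(y <- s) y) ->
  exists2 y, y \in s & divides p y.
Proof.
case=> _ pNu pP; elim: s => [|x s IHs].
  by rewrite big_nil => /(divides_unit (unitr1 R)); rewrite (negPf pNu).
rewrite big_cons => /pP[px|/IHs[y ys py]].
  by exists x => //; rewrite mem_head.
by exists y => //; rewrite inE ys orbT.
Qed.

Lemma prime_irreducible p : prime_elt p -> irreducible_elt p.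
Proof.
case=> p0 pNu pP; split=> // a b pab.
have [] := pP a b; first by rewrite -pab; apply: dividesxx.
  case=> c aE; right; apply/unitrPr; exists c.
  by apply: (mulfI p0); rewrite mulr1 {2}pab aE; ring.
case=> c bE; left; apply/unitrPr; exists c.
by apply: (mulfI p0); rewrite mulr1 {2}pab bE; ring.
Qed.

Lemma associated_refl x : associated x x.
Proof. by exists 1; rewrite ?unitr1 ?mul1r. Qed.

Lemma associated_sym x y : associated x y -> associated y x.
Proof.
by case=> e eU ->; exists e^-1; rewrite ?unitrV // mulKr.
Qed.

Lemma associated_trans y x z : associated x y -> associated y z ->
  associated x z.
Proof.
by case=> e eU -> [f fU ->]; exists (e * f); rewrite ?unitrM ?eU ?mulrA.
Qed.

Lemma associated_divides x y : associated x y -> divides y x.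
Proof. by case=> e eU ->; exists e; rewrite mulrC. Qed.

Lemma essentially_same_cons x y s t : associated y x -> essentially_same s t ->
  essentially_same (x :: s) (y :: t).
Proof.
move=> yx [sz [t' t't nt]]; split; first by rewrite /= sz.
exists (y :: t'); first by rewrite perm_cons.
by case=> [|i] //= /nt.
Qed.

Lemma essentially_same_nil : essentially_same [::] ([::] : seq R).
Proof. by split=> //; exists [::]. Qed.

Lemma essentially_same_permr s t t' : perm_eq t t' -> essentially_same s t ->
  essentially_same s t'.
Proof.
move=> tt' [sz [u ut nu]]; split; first by rewrite sz (perm_size tt').
by exists u => //; rewrite (perm_trans ut).
Qed.

(** [essentially_same] permutes only its second list, so a rearrangement of the first is transferred
    by applying the same index list to the witness [u]. *)
Lemma essentially_same_perml s s' t : perm_eq s s' -> essentially_same s t ->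
  essentially_same s' t.
Proof.
rewrite perm_sym => ss' [sz [u ut nu]].
have szu : size u = size s by rewrite (perm_size ut).
split; first by rewrite (perm_size ss').
have /(perm_iotaP 0)[Is Is_perm s'E] := ss'.
exists [seq nth 0 u i | i <- Is].
  apply: (perm_trans _ ut); apply/(perm_iotaP 0).
  by exists Is => //; rewrite szu.
move=> i; rewrite s'E size_map => ilt; rewrite !(nth_map 0%N) //.
apply: nu; have : nth 0%N Is i \in Is by apply: mem_nth.
by rewrite (perm_mem Is_perm) mem_iota.
Qed.

Lemma essentially_same_mem s t x : essentially_same s t -> x \in s ->
  exists2 y, y \in t & associated y x.
Proof.
move=> [sz [t' t't nt]] xs.
have ilt : (index x s < size s)%N by rewrite index_mem.
exists (nth 0 t' (index x s)); last by have := nt _ ilt; rewrite nth_index.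
by rewrite -(perm_mem t't) mem_nth // (perm_size t't) -sz.
Qed.

Lemma factorization_neq0 r s : factorization r s -> r != 0.
Proof.
case=> irr ->; rewrite prodf_seq_neq0; apply/allP => x /irr[-> _ _] //.
Qed.

Lemma factorization_nonunit r s : (0 < size s)%N -> factorization r s ->
  r \isn't a GRing.unit.
Proof.
case: s => // x s _ [irr ->]; rewrite big_cons unitrM negb_and.
by have [_ -> _] := irr x (mem_head _ _).
Qed.

Lemma factorization_cat a b s t : factorization a s -> factorization b t ->
  factorization (a * b) (s ++ t).
Proof.
case=> irrs -> [irrt ->]; split; last by rewrite big_cat.
by move=> x; rewrite mem_cat => /orP[/irrs|/irrt].
Qed.

Lemma irreducible_assoc x y : associated y x -> irreducible_elt x ->
  irreducible_elt y.
Proof.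
case=> e eU -> [x0 xNu xP]; split.
- by rewrite mulf_neq0 //; apply: contraTneq eU => ->; rewrite unitr0.
- by rewrite unitrM eU.
move=> a b eab; have [] := xP (e^-1 * a) b.
- by rewrite -mulrA -eab mulKr.
- by rewrite unitrM => /andP[]; left.
by right.
Qed.

(** If [a b = p c], one factorization of [a b] extends [p] and another joins those of [a] and [b];
    uniqueness makes [p] an associate of a factor of [a] or of [b]. *)
Lemma ufd_irreducible_prime p : is_ufd R -> irreducible_elt p -> prime_elt p.
Proof.
move=> ufd irrp; have [p0 pNu pP] := irrp; split=> // a b.
have [-> _|a0] := eqVneq a 0; first by left; apply: divides0.
have [-> _|b0] := eqVneq b 0; first by right; apply: divides0.
have [aU|aNu] := boolP (a \is a GRing.unit).
  by move=> /(divides_mull a^-1); rewrite mulKr //; right.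
have [bU|bNu] := boolP (b \is a GRing.unit).
  by move=> /(divides_mulr b^-1); rewrite mulrK //; left.
case=> c abE.
have [[sa fsa] _] := ufd a a0 aNu.
have [[sb fsb] _] := ufd b b0 bNu.
have [_ aE] := fsa; have [_ bE] := fsb.
have fab := factorization_cat fsa fsb.
have ab0 : a * b != 0 by rewrite mulf_neq0.
have abNu : a * b \isn't a GRing.unit by rewrite unitrM (negPf aNu).
(* A unit [c] need not be a product of irreducibles; it is absorbed into [p], hence only an
   associate [q] of [p] is asked for. *)
have [q [u fq qp]] : exists q, exists2 s, factorization (a * b) (q :: s) &
    associated p q.
  have c0 : c != 0 by apply: contraNneq ab0 => c0; rewrite abE c0 mulr0.
  have [cU|cNu] := boolP (c \is a GRing.unit).
    have pcp : associated (p * c) p by exists c; rewrite // mulrC.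
    exists (p * c), [::]; last exact: associated_sym.
    split; last by rewrite big_seq1.
    by move=> x; rewrite inE => /eqP ->; apply: irreducible_assoc pcp irrp.
  have [[sc [irrc cE]] _] := ufd c c0 cNu.
  exists p, sc; last exact: associated_refl.
  split; last by rewrite big_cons -cE.
  by move=> x; rewrite inE => /predU1P[-> //|/irrc].
have [_ /(_ _ _ fq fab)/essentially_same_mem] := ufd _ ab0 abNu.
case/(_ q (mem_head _ _)) => y + yq.
have py : divides p y.
  apply: divides_trans (associated_divides yq).
  exact/associated_divides/associated_sym.
rewrite mem_cat aE bE => /orP[] /divides_prod_mem /(divides_trans py);
  by [left | right].
Qed.

(** The unit [e] keeps the induction going: cancelling the head of [s] against its associate in [t]
    leaves a unit, which joins [e]. *)
Lemma prime_factorizations_same s t e : e \is a GRing.unit ->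
  (forall x, x \in s -> prime_elt x) -> (forall x, x \in t -> prime_elt x) ->
  \prod_(x <- s) x = e * \prod_(x <- t) x -> essentially_same s t.
Proof.
elim: s t e => [|x s IHs] t e eU ps pt.
  rewrite big_nil; case: t pt => [_ _|y t pt] ; first exact: essentially_same_nil.
  rewrite big_cons => /esym E; have [_ /negP[]] := pt y (mem_head _ _).
  apply: (divides_unit (unitr1 _)); rewrite -E.
  by apply/divides_mull/divides_mulr/dividesxx.
rewrite big_cons => E.
have px := ps x (mem_head _ _); have [x0 xNu xP] := px.
have [] := xP e (\prod_(x <- t) x).
  by rewrite -E; apply/divides_mulr/dividesxx.
- by move/(divides_unit eU); rewrite (negPf xNu).
move/(prime_divides_prod px) => [y yt [c yE]].
have cU : c \is a GRing.unit.
  have [_ _ /(_ _ _ yE)[]] := prime_irreducible (pt y yt) => //.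
  by rewrite (negPf xNu).
have yx : associated y x by exists c => //; rewrite mulrC.
apply: essentially_same_permr (_ : perm_eq (y :: rem y t) t) _.
  by rewrite perm_sym perm_to_rem.
apply: essentially_same_cons => //; apply: (IHs _ (e * c)).
- by rewrite unitrM eU.
- by move=> z zs; apply: ps; rewrite inE zs orbT.
- by move=> z /mem_rem; apply: pt.
apply: (mulfI x0); rewrite E (big_rem y) //= yE; ring.
Qed.

Lemma atomic_prime_ufd :
  (forall r, r != 0 -> r \isn't a GRing.unit -> exists s, factorization r s) ->
  (forall p, irreducible_elt p -> prime_elt p) -> is_ufd R.
Proof.
move=> atomic irrP r r0 rNu; split; first exact: atomic.
move=> s t [irrs rs] [irrt rt].
apply: (@prime_factorizations_same _ _ 1); rewrite ?unitr1 //.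
- by move=> x /irrs/irrP.
- by move=> x /irrt/irrP.
- by rewrite mul1r -rs.
Qed.

(** Denominators and valuations are treated with this below, one prime at a time. *)
Lemma ufd_ind (P : R -> Prop) : is_ufd R ->
  (forall u, u \is a GRing.unit -> P u) ->
  (forall p a, prime_elt p -> a != 0 -> P a -> P (p * a)) ->
  forall a, a != 0 -> P a.
Proof.
move=> ufd Pu Pp a a0; have [/Pu //|aNu] := boolP (a \is a GRing.unit).
have [[s [irr aE]] _] := ufd a a0 aNu; rewrite aE in a0 *; clear -ufd Pu Pp irr a0.
elim: s irr a0 => [|p s IHs] irr.
  by rewrite big_nil => _; apply: Pu; rewrite unitr1.
rewrite big_cons mulf_eq0 negb_or => /andP[p0 s0].
apply: Pp => //; first exact/ufd_irreducible_prime/irr/mem_head.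
by apply: IHs => // x xs; apply: irr; rewrite inE xs orbT.
Qed.

(** The [p]-adic valuation as a relation, so that [0] gets no artificial value: for [p != 0] the
    relation holds for no [k] there. *)
Definition exact_power p a (k : nat) : Prop :=
  exists2 m, a = p ^+ k * m & ~ divides p m.

Section Exact.
Variables (p : R) (p_prime : prime_elt p).

Lemma exact_power0 a : ~ divides p a -> exact_power p a 0.
Proof. by exists a => //; rewrite expr0 mul1r. Qed.

Lemma exact_powerM a b k l : exact_power p a k -> exact_power p b l ->
  exact_power p (a * b) (k + l).
Proof.
case: p_prime => _ _ pP [m -> pm] [n -> pn]; exists (m * n).
  by rewrite exprD; ring.
by move=> /pP[].
Qed.

Lemma exact_power_divides a k n : exact_power p a k ->
  divides (p ^+ n) a <-> (n <= k)%N.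
Proof.
case: p_prime => p0 pNu pP [m -> pm]; split; last first.
  by move=> nk; exists (p ^+ (k - n) * m); rewrite mulrA -exprD subnKC.
move=> [c E]; rewrite leqNgt; apply/negP => kn; apply: pm.
exists (p ^+ (n - k.+1) * c); apply: (mulfI (expf_neq0 k p0)).
by rewrite E !mulrA -exprSr -exprD; congr (_ ^+ _ * _); lia.
Qed.

Lemma exact_power_uniq a k l : exact_power p a k -> exact_power p a l -> k = l.
Proof.
move=> ak al; apply/eqP; rewrite eqn_leq; apply/andP; split.
  by apply/(exact_power_divides _ al)/(exact_power_divides _ ak).
by apply/(exact_power_divides _ ak)/(exact_power_divides _ al).
Qed.

Lemma exact_power_unit u : u \is a GRing.unit -> exact_power p u 0.
Proof.
case: p_prime => _ pNu _ uU; apply: exact_power0 => /(divides_unit uU).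
by rewrite (negPf pNu).
Qed.

(** Values add up along a prime factorization; a prime [q] contributes 1 if [p] divides it, as the
    cofactor is then a unit, and 0 otherwise. *)
Lemma exact_power_exists a : is_ufd R -> a != 0 -> exists k, exact_power p a k.
Proof.
move=> ufd; move: a.
apply: (ufd_ind (P := fun a => exists k, exact_power p a k)) => //.
  by move=> u uU; exists 0%N; apply: exact_power_unit.
move=> q b q_prime b0 [k bk].
case: (pselect (divides p q)) => [[c qE]|pq]; last first.
  by exists (0 + k)%N; apply: exact_powerM => //; apply: exact_power0.
exists (1 + k)%N; apply: exact_powerM => //; exists c => //.
have [_ _ /(_ _ _ qE)[|cU /(divides_unit cU)]] := prime_irreducible q_prime;
  by case: p_prime => _ /negPf ->.
Qed.

Lemma exact_power_prod (I : Type) (r : seq I) (P : pred I) (F : I -> R)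
    (v : I -> nat) :
  (forall i, P i -> exact_power p (F i) (v i)) ->
  exact_power p (\prod_(i <- r | P i) F i) (\sum_(i <- r | P i) v i)%N.
Proof.
move=> Fv; elim/big_ind2: _ => //; first exact/exact_power_unit/unitr1.
by move=> *; apply: exact_powerM.
Qed.

End Exact.
End Divisibility.

(** * Gauss's lemma *)

Section PolynomialUFD.
Variables (D : idomainType) (D_ufd : is_ufd D).
Implicit Types (a b d p : D) (f g h : {poly D}).
Local Notation K := {fraction D}.
Local Notation tofrac := (@FracField.tofrac D).
Local Notation "f ^K" := (map_poly tofrac f) (at level 2, format "f ^K").

Lemma tofrac_inj : injective tofrac.
Proof. by move=> a b /eqP; rewrite tofrac_eq => /eqP. Qed.

Lemma divides_polyC p f : divides p%:P f <-> forall i, divides p f`_i.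
Proof.
split=> [[g ->] i|pf]; first by exists g`_i; rewrite coefCM.
exists (\poly_(i < size f) projT1 (cid (pf i))).
apply/polyP => i; rewrite coefCM coef_poly.
case: ltnP => [_|/leq_sizeP->//]; last by rewrite mulr0.
by case: cid.
Qed.

Lemma not_divides_polyC p f : ~ divides p%:P f ->
  exists2 i, ~ divides p f`_i & forall j, (j < i)%N -> divides p f`_j.
Proof.
move=> /divides_polyC /existsNP[i0 Hi0].
have exi : exists i, `[< ~ divides p f`_i >] by exists i0; apply/asboolP.
case: (ex_minnP exi) => i /asboolP Hi mini; exists i => // j ji.
apply: contrapT => Hj; have := mini j; rewrite leqNgt ji.
by case/(_ (asboolT Hj))/negP.
Qed.

(** Let [i] and [j] be the lowest indices at which [p] fails to divide a coefficient of [f] and of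
    [g]; in the coefficient [i + j] of [f * g] every other term is divisible by [p]. *)
Lemma prime_elt_polyC p : prime_elt p -> prime_elt p%:P.
Proof.
move=> [p0 pNu pP]; split; rewrite ?polyC_eq0 //.
  by rewrite poly_unitE coefC eqxx negb_and pNu orbT.
move=> f g pfg; apply: contrapT => /not_orP[].
move=> /not_divides_polyC[i Hi mini] /not_divides_polyC[j Hj minj].
have /(_ (i + j)%N) := (divides_polyC p (f * g)).1 pfg.
have ilt : (i < (i + j).+1)%N by rewrite ltnS leq_addr.
rewrite coefM (bigD1 (Ordinal ilt)) //= addKn => pS.
suff : divides p (f`_i * g`_j) by case/pP.
rewrite -[X in divides p X](addrK (\sum_(k < (i + j).+1 | k != Ordinal ilt)
  f`_k * g`_(i + j - k))).
apply: divides_sub => //; apply: divides_sum => k.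
rewrite -val_eqE /= neq_ltn => /orP[ki|ik].
  exact/divides_mulr/mini.
by apply/divides_mull/minj; have := ltn_ord k; lia.
Qed.

Lemma fraction_clear (c : K) :
  exists a b, b != 0 /\ tofrac b * c = tofrac a.
Proof.
have [x ->] : exists x, c = \pi_K%qT x by exists (repr c); rewrite reprK.
exists \n_x, \d_x; split; first exact: denom_ratioP.
unlock FracField.tofrac.
rewrite -[LHS]FracField.pi_mul; apply/eqmodP.
rewrite /= FracField.equivfE /FracField.mulf.
by rewrite !numden_Ratio ?mulf_neq0 ?denom_ratioP ?oner_neq0 // mulr1 mul1r.
Qed.

Lemma clear_denominators (q : {poly K}) :
  exists d g, d != 0 /\ tofrac d *: q = g^K.
Proof.
elim/poly_ind: q => [|q c [d [g [d0 dg]]]].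
  by exists 1, 0; rewrite oner_neq0 scaler0 rmorph0.
have [a [b [b0 bc]]] := fraction_clear c.
exists (d * b), (b *: (g * 'X) + (d * a)%:P); split; first by rewrite mulf_neq0.
rewrite -!mul_polyC rmorphD !rmorphM /= !map_polyC map_polyX /= -dg.
rewrite -!mul_polyC -bc !polyCM.
by move: (tofrac d)%:P (tofrac b)%:P c%:P => x y z; ring.
Qed.

Lemma size_tofrac_poly f : size f^K = size f.
Proof. exact/size_map_inj_poly/rmorph0/tofrac_inj. Qed.

Lemma tofrac_poly_inj : injective (fun f => f^K).
Proof. by apply: map_inj_poly; [exact: tofrac_inj | rewrite rmorph0]. Qed.

Lemma divp_tofrac f g : f^K %| g^K ->
  exists d h, d != 0 /\ d%:P * g = f * h.
Proof.
move=> /dvdpP[q gE]; have [d [h [d0 dh]]] := clear_denominators q.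
exists d, h; split => //; apply: tofrac_poly_inj.
by rewrite !rmorphM /= map_polyC /= gE mul_polyC scalerAl dh mulrC.
Qed.

(** Each prime of [d] divides [f * k], where [k] is the cofactor, but not [f]; so it divides [k] and
    can be cancelled. *)
Lemma primitive_divides_cancel f h d : d != 0 ->
  (forall p, prime_elt p -> ~ divides p%:P f) ->
  divides f (d%:P * h) -> divides f h.
Proof.
move=> d0 prim; move: d d0 h.
apply: (ufd_ind (P := fun d => forall h, divides f (d%:P * h) -> divides f h)).
- exact: D_ufd.
- move=> u uU h /(divides_mull (u^-1)%:P).
  by rewrite mulrA -polyCM mulVr // mul1r.
move=> p a p_prime a0 IH h [k E]; apply: IH.
have [pC0 _ /(_ f k)[]] := prime_elt_polyC p_prime.
- by rewrite -E polyCM -mulrA; apply/divides_mulr/dividesxx.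
- by move/prim; case.
move=> [k' k'E]; exists k'; apply: (mulfI pC0).
by rewrite [RHS]mulrCA -k'E -E polyCM mulrA.
Qed.

(** Each prime of [d] divides [g] or [h] and is removed there. Only constants are removed, so the
    sizes survive; this turns a factorization over [K] into one over [D]. *)
Lemma split_off_constant f g h d : d != 0 -> d%:P * f = g * h ->
  exists g' h', [/\ f = g' * h', size g' = size g & size h' = size h].
Proof.
move=> d0; move: d d0 g h.
apply: (ufd_ind (P := fun d => forall g h, d%:P * f = g * h ->
  exists g' h', [/\ f = g' * h', size g' = size g & size h' = size h])).
- exact: D_ufd.
- move=> u uU g h E; exists (u^-1 *: g), h; split=> //.
    by rewrite -scalerAl -E -mul_polyC mulrA -polyCM mulVr // mul1r.
  by rewrite size_scale // invr_eq0; apply: contraTneq uU => ->; rewrite unitr0.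
move=> p a p_prime a0 IH g h; rewrite polyCM -mulrA => E.
have [pC0 _ /(_ g h)[]] := prime_elt_polyC p_prime.
- by rewrite -E; apply/divides_mulr/dividesxx.
- move=> [g1 g1E]; have := E; rewrite g1E -mulrA => /(mulfI pC0) /IH.
  case=> g' [h' [-> sg sh]]; exists g', h'; split=> //.
  by rewrite ?sg ?sh mul_polyC size_scale // -polyC_eq0.
- move=> [h1 h1E]; have := E; rewrite h1E [RHS]mulrCA => /(mulfI pC0) /IH.
  case=> g' [h' [-> sg sh]]; exists g', h'; split=> //.
  by rewrite ?sg ?sh mul_polyC size_scale // -polyC_eq0.
Qed.

(** Constants are handled in [D]. A nonconstant [f] is primitive, and over [K] it either is coprime
    to [g], so that it divides [h], or shares with [g] a factor that must be all of [f]. *)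
Lemma irreducible_poly_prime f : irreducible_elt f -> prime_elt f.
Proof.
move=> irrf; have [f0 fNu fP] := irrf.
have [f1|f1] := leqP (size f) 1.
  have fC := size1_polyC f1; rewrite fC; apply: prime_elt_polyC.
  apply: ufd_irreducible_prime => //; split.
  - by rewrite -polyC_eq0 -fC.
  - move: fNu; rewrite poly_unitE eqn_leq f1 /= size_poly_gt0 f0 /=.
    by rewrite fC coefC.
  move=> a b abE; have [] := fP a%:P b%:P; first by rewrite -polyCM -abE.
  - by rewrite poly_unitE coefC => /andP[_]; left.
  - by rewrite poly_unitE coefC => /andP[_]; right.
have prim p : prime_elt p -> ~ divides p%:P f.
  move=> p_prime [k fE]; have [_ pNu _] := prime_elt_polyC p_prime.
  have [] := fP _ _ fE; first by rewrite (negPf pNu).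
  rewrite poly_unitE => /andP[/eqP k1 _]; move: f1.
  rewrite fE mul_polyC size_scale ?k1 //; by case: p_prime.
split=> // g h [k ghE].
(* By [prim] the polynomial [f] is primitive, so divisibility over [K] descends to [D]. *)
have reduce l : f^K %| l^K -> divides f l.
  case/divp_tofrac=> d [l' [d0 E]].
  by apply: (primitive_divides_cancel d0) => //; exists l'.
have [cop|] := boolP (coprimep f^K g^K).
  by right; apply: reduce; rewrite -(Gauss_dvdpr _ cop) -rmorphM ghE rmorphM dvdp_mulIl.
rewrite coprimep_def => e1; left; apply: reduce.
set e := gcdp _ _ in e1.
have ef : e %| f^K := dvdp_gcdl _ _; have eg : e %| g^K := dvdp_gcdr _ _.
have fK0 : f^K != 0 by rewrite -size_poly_gt0 size_tofrac_poly size_poly_gt0.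
have [d [e' [d0 ee']]] := clear_denominators e.
have tofracd0 : tofrac d != 0 by rewrite tofrac_eq0.
have : e'^K %| f^K by rewrite -ee' dvdpZl.
case/divp_tofrac=> d' [k' [d'0 /(split_off_constant d'0)]].
case=> g1 [h1 [fE sg sh]].
have se : size g1 = size e by rewrite sg -size_tofrac_poly -ee' size_scale.
(* [g1] has the size of the gcd, which is not 1, so irreducibility makes the cofactor [h1] constant
   and the gcd has the full degree of [f]. *)
have [] := fP _ _ fE; rewrite poly_unitE => /andP[/eqP s1 _].
  by rewrite -se s1 in e1.
suff : e %= f^K by move/eqp_dvdl => <-.
rewrite -dvdp_size_eqp // size_tofrac_poly fE.
have [g10 h10] : g1 != 0 /\ h1 != 0.
  by apply/andP; rewrite -negb_or -mulf_eq0 -fE.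
by rewrite size_mul // s1 addn1 se.
Qed.

(** The number of prime factors with multiplicity; the product is taken up to a unit so that units
    have length 0. *)
Definition prime_length a n : Prop :=
  exists s, [/\ size s = n, forall x, x \in s -> prime_elt x
    & associated a (\prod_(x <- s) x)].

Lemma prime_length_exists a : a != 0 -> exists n, prime_length a n.
Proof.
move: a; apply: (ufd_ind (P := fun a => exists n, prime_length a n)) => //.
  by move=> u uU; exists 0%N, [::]; split=> //; exists u; rewrite ?big_nil ?mulr1.
move=> p a p_prime a0 [n [s [sn ps [e eU aE]]]].
exists n.+1, (p :: s); split; first by rewrite /= sn.
  by move=> x; rewrite inE => /predU1P[->|/ps].
by exists e => //; rewrite big_cons aE mulrCA.
Qed.

Lemma prime_lengthM a b n m : prime_length a n -> prime_length b m ->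
  prime_length (a * b) (n + m).
Proof.
move=> [s [<- ps [e eU ->]]] [t [<- pt [f fU ->]]]; exists (s ++ t); split.
- by rewrite size_cat.
- by move=> x; rewrite mem_cat => /orP[/ps|/pt].
by exists (e * f); rewrite ?unitrM ?eU // big_cat /=; ring.
Qed.

Lemma prime_length_uniq a n m : prime_length a n -> prime_length a m -> n = m.
Proof.
move=> [s [<- ps [e eU ->]]] [t [<- pt [f fU E]]].
have [] // := @prime_factorizations_same D s t (e^-1 * f); rewrite ?unitrM ?unitrV ?eU //.
by rewrite -mulrA -E mulKr.
Qed.

Lemma poly_nonunit_measure f n : f != 0 -> f \isn't a GRing.unit ->
  prime_length (lead_coef f) n -> (1 < size f + n)%N.
Proof.
move=> f0 fNu fn; have f1 : (0 < size f)%N by rewrite size_poly_gt0.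
have [f2|] := leqP (size f) 1; last by lia.
case: n fn => [|n _]; last by lia.
case=> -[|x s] [] // _ _ [e eU]; rewrite big_nil mulr1 => le; case/negP: fNu.
rewrite poly_unitE eqn_leq f2 f1 /=; move: le eU.
rewrite lead_coefE (size1_polyC f2) => <-; rewrite !coefC.
by case: (size _).-1 => //=; rewrite unitr0.
Qed.

(** Induction on [size f] plus the prime length of the leading coefficient. The measure of a product
    is the sum of the measures minus one, and a nonunit has measure at least 2, so both factors of a
    proper decomposition measure less. *)
Lemma poly_atomic f : f != 0 -> f \isn't a GRing.unit ->
  exists s, factorization f s.
Proof.
move=> f0; have [n] : exists n, prime_length (lead_coef f) n.
  by apply: prime_length_exists; rewrite lead_coef_eq0.
have [N] := ubnP (size f + n)%N.
elim: N f f0 n => [//|N IH] f f0 n leN fn fNu.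
have [irr|] := pselect (irreducible_elt f).
  exists [:: f]; split; last by rewrite big_seq1.
  by move=> x; rewrite inE => /eqP->.
move=> Nirr; have [[a b] [fE aNu bNu]] : exists ab : {poly D} * {poly D},
    [/\ f = ab.1 * ab.2, ab.1 \isn't a GRing.unit & ab.2 \isn't a GRing.unit].
  apply: contrapT => /forallNP H; apply: Nirr; split=> // a b abE.
  apply/orP; rewrite -[_ || _]negbK negb_or; apply/negP => /andP[aN bN].
  by apply: (H (a, b)).
rewrite /= in fE aNu bNu.
have [a0 b0] : a != 0 /\ b != 0 by apply/andP; rewrite -negb_or -mulf_eq0 -fE.
have [na Ha] : exists n, prime_length (lead_coef a) n.
  by apply: prime_length_exists; rewrite lead_coef_eq0.
have [nb Hb] : exists n, prime_length (lead_coef b) n.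
  by apply: prime_length_exists; rewrite lead_coef_eq0.
have nE : n = (na + nb)%N.
  by apply: prime_length_uniq fn _; rewrite fE lead_coefM; apply: prime_lengthM.
have sE : size f = (size a + size b).-1 by rewrite fE size_mul.
have := poly_nonunit_measure a0 aNu Ha; have := poly_nonunit_measure b0 bNu Hb.
move=> mb ma.
have [|s fs] := IH a a0 na _ Ha aNu; first by lia.
have [|t ft] := IH b b0 nb _ Hb bNu; first by lia.
by exists (s ++ t); rewrite fE; apply: factorization_cat.
Qed.

Lemma poly_ufd : is_ufd {poly D}.
Proof.
exact: atomic_prime_ufd poly_atomic irreducible_poly_prime.
Qed.

End PolynomialUFD.

Local Open Scope classical_set_scope.

(** * The ring of integer-valued polynomials *)

Section UFDTransfer.
Variables (R S : idomainType) (phi : R -> S).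
Hypotheses (phi_inj : injective phi) (phi_surj : forall y, exists x, phi x = y).
Hypotheses (phiM : {morph phi : x y / x * y}) (phi1 : phi 1 = 1) (phi0 : phi 0 = 0).

Lemma iso_unit x : (phi x \is a GRing.unit) = (x \is a GRing.unit).
Proof.
apply/idP/idP => /unitrPr[y xy]; apply/unitrPr.
  by have [z zy] := phi_surj y; exists z; apply: phi_inj; rewrite phiM zy phi1.
by exists (phi y); rewrite -phiM xy phi1.
Qed.

Lemma iso_divides a b : divides (phi a) (phi b) <-> divides a b.
Proof.
split=> [[y]|[c ->]]; last by exists (phi c); rewrite phiM.
by have [c <-] := phi_surj y; rewrite -phiM => /phi_inj ->; exists c.
Qed.

Lemma iso_neq0 x : (phi x != 0) = (x != 0).
Proof. by rewrite -phi0 (inj_eq phi_inj). Qed.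

Lemma iso_irreducible x : irreducible_elt (phi x) <-> irreducible_elt x.
Proof.
rewrite /irreducible_elt iso_neq0 iso_unit; split=> -[x0 xNu xP]; split=> //.
  by move=> a b xab; have := xP (phi a) (phi b); rewrite !iso_unit -phiM xab; apply.
move=> y z; have [a <-] := phi_surj y; have [b <-] := phi_surj z.
by rewrite -phiM !iso_unit => /phi_inj/xP.
Qed.

Lemma iso_ufd : is_ufd R -> is_ufd S.
Proof.
move=> ufd; apply: atomic_prime_ufd => y; have [x <-] := phi_surj y.
  rewrite iso_neq0 iso_unit => x0 xNu.
  have [[s [irr ->]] _] := ufd x x0 xNu; exists (map phi s); split.
    by move=> _ /mapP[z zs ->]; apply/iso_irreducible/irr.
  by rewrite big_map (big_morph phi phiM phi1).
move/iso_irreducible/(ufd_irreducible_prime ufd) => [x0 xNu xP].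
split; rewrite ?iso_neq0 ?iso_unit // => a b.
have [c <-] := phi_surj a; have [d <-] := phi_surj b.
by rewrite -phiM !iso_divides; apply: xP.
Qed.
End UFDTransfer.

Section IntBasics.
Variable D : idomainType.
Implicit Types (a b d p : D) (f g h : Int D).
Local Notation K := {fraction D}.
Local Notation tofrac := (@FracField.tofrac D).
Local Notation "f ^K" := (map_poly tofrac f) (at level 2, format "f ^K").

(** [Int D] is [Int_ring D] with a classical unit structure on top; the projection is restated at
    this type so that products there can be read in [K[X]]. *)
Definition Int_poly f : {poly K} := Int_val (f : Int_ring D).

Lemma Int_poly_inj : injective Int_poly.
Proof. exact: val_inj. Qed.

Lemma Int_polyM : {morph Int_poly : f g / f * g}.
Proof. exact: (rmorphM (val : Int_ring D -> {poly K})). Qed.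

Lemma Int_poly1 : Int_poly 1 = 1.
Proof. exact: (rmorph1 (val : Int_ring D -> {poly K})). Qed.

Lemma Int_poly0 : Int_poly 0 = 0.
Proof. exact: (rmorph0 (val : Int_ring D -> {poly K})). Qed.

Lemma Int_poly_prod (I : Type) (r : seq I) (P : pred I) (F : I -> Int D) :
  Int_poly (\prod_(i <- r | P i) F i) = \prod_(i <- r | P i) Int_poly (F i).
Proof. exact: (big_morph Int_poly Int_polyM Int_poly1). Qed.

Lemma Int_poly_valued f : Int_set D (Int_poly f).
Proof. by apply/asboolP; case: (f : Int_ring D). Qed.

Definition mk_Int (q : {poly K}) (Dq : Int_set D q) : Int D := MkInt (asboolT Dq).

Lemma mk_IntK q (Dq : Int_set D q) : Int_poly (mk_Int Dq) = q.
Proof. by []. Qed.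

Lemma Int_set_base (q : {poly D}) : Int_set D q^K.
Proof. by move=> a; exists q.[a]; rewrite horner_map. Qed.

(** Write [q = r / d] with [d] in [D]. All values of [r] are multiples of [d], and the hypothesis
    removes the primes of [d] from [r] one by one, so the quotient has coefficients in [D]. *)
Lemma Int_set_eq_base :
  is_ufd D ->
  (forall p (q : {poly D}), prime_elt p -> (forall a, divides p q.[a]) ->
     divides p%:P q) ->
  Int_set D = polys_over_base D.
Proof.
move=> D_ufd vanish; apply/seteqP; split=> [q Dq|_ [r _ <-]]; last first.
  exact: Int_set_base.
have [d [r [d0 qr]]] := clear_denominators q.
have rd a : divides d r.[a].
  have [b qb] := Dq a; exists b; apply: tofrac_inj.
  by rewrite -horner_map -qr hornerZ qb -rmorphM.
have [r' r'E] : divides d%:P r.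
  move: d d0 r rd {qr}.
  apply: (ufd_ind (P := fun d => forall r, (forall a, divides d r.[a]) ->
    divides d%:P r)) => //.
    move=> u uU r _; exists (u^-1 *: r).
    by rewrite mul_polyC scalerA mulrV // scale1r.
  move=> p a p_prime a0 IH r par.
  have [r' r'E] : divides p%:P r.
    apply: vanish => // x; apply: divides_trans (par x).
    exact/divides_mulr/dividesxx.
  have [r'' r''E] : divides a%:P r'.
    apply: IH => x; have [c] := par x; rewrite r'E hornerM hornerC -mulrA.
    by case: p_prime => p0 _ _ /(mulfI p0) ->; exists c.
  by exists r''; rewrite r'E r''E polyCM mulrA.
exists r' => //; have d0K : tofrac d != 0 by rewrite tofrac_eq0.
apply: (scalerI d0K).
by rewrite qr r'E rmorphM /= map_polyC /= mul_polyC.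
Qed.

Lemma Int_ufd : is_ufd D -> Int_set D = polys_over_base D -> is_ufd (Int D).
Proof.
move=> D_ufd IntE.
apply: (@iso_ufd _ _ (fun q => mk_Int (Int_set_base q))); last exact: poly_ufd.
- by move=> q r /(congr1 Int_poly)/tofrac_poly_inj.
- move=> f; have := Int_poly_valued f; rewrite IntE => -[q _ qE]; exists q.
  exact: Int_poly_inj.
- by move=> q r; apply: Int_poly_inj; rewrite Int_polyM !mk_IntK rmorphM.
- by apply: Int_poly_inj; rewrite Int_poly1 !mk_IntK rmorph1.
- by apply: Int_poly_inj; rewrite Int_poly0 !mk_IntK rmorph0.
Qed.

End IntBasics.

(** The lengths 2, 2 already call for an element with two essentially different factorizations. *)
Lemma full_not_ufd (R : idomainType) :
  full_system_of_multisets_of_lengths R -> ~ is_ufd R.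
Proof.
move=> full ufd; have [] := full 2%N (fun=> 2%N) => // H [s [fs ss sN _]].
apply: (sN ord0 ord_max) => //.
have H0 := factorization_neq0 (fs ord0).
have HNu : H \isn't a GRing.unit.
  by apply: factorization_nonunit (fs ord0); rewrite ss.
by have [_] := ufd H H0 HNu; apply.
Qed.

(** * The zero ideal and the ideal of a prime element, as prime ideals *)

Section HeightOne.
Variable D : idomainType.

Definition zero_ideal : D -> bool := fun x => x == 0.

Fact zero_ideal_closed : idealr_closed zero_ideal.
Proof.
split=> [||a u v]; rewrite /in_mem /= /zero_ideal ?eqxx ?oner_neq0 //.
by move=> /eqP-> /eqP->; rewrite mulr0 addr0.
Qed.
HB.instance Definition _ := isIdealr.Build D zero_ideal zero_ideal_closed.

Fact zero_ideal_prime : prime_idealr_closed zero_ideal.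
Proof. by move=> u v; rewrite /in_mem /= /zero_ideal mulf_eq0. Qed.
HB.instance Definition _ :=
  isPrimeIdealrClosed.Build D zero_ideal zero_ideal_prime.

Definition zero_prime_ideal : prime_idealr D := zero_ideal.

(** The primality proof is an argument so that the prime ideal structure can be attached to this
    predicate. *)
Definition principal (p : D) of prime_elt p : D -> bool :=
  fun x => `[< divides p x >].

Variables (p : D) (p_prime : prime_elt p).

Fact principal_closed : idealr_closed (principal p_prime).
Proof.
split=> [||a u v]; rewrite /in_mem /= /principal.
- exact/asboolT/divides0.
- apply/asboolP => /(divides_unit (unitr1 D)).
  by case: p_prime => _ /negPf ->.
move=> /asboolP pu /asboolP pv; apply/asboolP.
by apply: divides_add => //; apply: divides_mull.
Qed.
HB.instance Definition _ := isIdealr.Build D (principal p_prime) principal_closed.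

Fact principal_prime : prime_idealr_closed (principal p_prime).
Proof.
move=> u v; rewrite /in_mem /= /principal => /asboolP.
by case: p_prime => _ _ pP /pP[] H; apply/orP; [left|right]; apply/asboolP.
Qed.
HB.instance Definition _ :=
  isPrimeIdealrClosed.Build D (principal p_prime) principal_prime.

Definition principal_ideal : prime_idealr D := principal p_prime.

Lemma principal_idealP x : reflect (divides p x) (x \in (principal_ideal : {pred D})).
Proof. exact: asboolP. Qed.

End HeightOne.

(** * Height-one primes and residue fields *)

Section Height.
Variables (D : idomainType) (D_ufd : is_ufd D).
Implicit Types (p x : D) (P Q : prime_idealr D).

Lemma prime_ideal_unit P x : x \is a GRing.unit -> x \notin (P : {pred D}).
Proof.
move=> xU; apply/negP => /(idealMr x^-1).
by rewrite mulVr // (@idealr1 D P).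
Qed.

Lemma strict_subideal_neq0 P Q : strict_subideal P Q ->
  exists x, [/\ x \in (Q : {pred D}), x \notin (P : {pred D}) & x != 0].
Proof.
case=> sub [x xQ xP]; exists x; split=> //.
by apply: contraNneq xP => ->; apply: (idealr0 P).
Qed.

Lemma prime_ideal_contains_prime P x : x != 0 -> x \in (P : {pred D}) ->
  exists2 p, prime_elt p & p \in (P : {pred D}).
Proof.
move: x; apply: (ufd_ind (P := fun x => x \in (P : {pred D}) ->
  exists2 p, prime_elt p & p \in (P : {pred D}))) => //.
  by move=> u uU /(negP (prime_ideal_unit P uU)).
move=> p a p_prime a0 IH; rewrite (prime_idealrM P).
by case/orP=> [pP|/IH //]; exists p.
Qed.

(** A nonzero element of [P] has a prime factor [p] in [P]. If [P] were larger than the ideal [(p)],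
    then [0], [(p)], [P] would be a chain of length 2. *)
Lemma height_one_principal P : has_height P 1 ->
  exists2 p, prime_elt p & forall x, x \in (P : {pred D}) <-> divides p x.
Proof.
case=> [[c [/(_ 0%N isT) /strict_subideal_neq0[x [xc1 _ x0]] c1P]] maxP].
have xP : x \in (P : {pred D}) by rewrite -c1P.
have [p p_prime pP] := prime_ideal_contains_prime x0 xP.
exists p => // y; split=> [yP|[z ->]]; last by rewrite (prime_idealrM P) pP.
apply: contrapT => py.
suff /maxP : prime_chain 2 P by [].
exists (fun i => if i is i'.+1 then if i' is _.+1 then P
  else principal_ideal p_prime else zero_prime_ideal D); split=> //.
have [p0 _ _] := p_prime.
case=> [|[|//]] _; split.
- by move=> _ /eqP->; apply: (idealr0 (principal_ideal p_prime)).
- by exists p => //; apply/principal_idealP/dividesxx.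
- by move=> _ /principal_idealP[z ->]; rewrite (prime_idealrM P) pP.
- by exists y => //; apply/principal_idealP.
Qed.

(** In a chain of length at least 2, the ideal just below [(p)] contains a prime [q]. As a multiple
    of [p], it is associated to [p], so that ideal already contains [p]. *)
Lemma principal_height_one p (p_prime : prime_elt p) :
  has_height (principal_ideal p_prime) 1.
Proof.
have [p0 /negPf pNu _] := p_prime.
split.
  exists (fun i => if i is _.+1 then principal_ideal p_prime
    else zero_prime_ideal D); split=> //.
  case=> // _; split.
    by move=> _ /eqP->; apply: (idealr0 (principal_ideal p_prime)).
  by exists p => //; apply/principal_idealP/dividesxx.
case=> [|[|n]] // [c [cS cP]].
have [x [xc _ x0]] := strict_subideal_neq0 (cS n (leqnSn _)).
have [sub [y yc2 yc1]] := cS n.+1 (leqnn _).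
have [q q_prime qc] := prime_ideal_contains_prime x0 xc.
have := sub q qc; rewrite cP => /principal_idealP[e qE].
have pc : p \in (c n.+1 : {pred D}).
  have [_ _ /(_ _ _ qE)[|eU]] := prime_irreducible q_prime.
    by rewrite pNu.
  by move: qc; rewrite qE (prime_idealrM (c n.+1)) (negPf (prime_ideal_unit _ eU)) orbF.
case/negP: yc1; move: yc2; rewrite cP => /principal_idealP[z ->].
by rewrite (prime_idealrM (c n.+1)) pc.
Qed.

(** * Finite and infinite residue rings *)

Section Residue.
Variables (P : prime_idealr D) (p : D).
Hypothesis PE : forall x, x \in (P : {pred D}) <-> divides p x.

Definition residue (x : D) : residue_domain P := \pi_({ideal_quot P})%qT x.

Fact residue_is_zmod_morphism : zmod_morphism residue.
Proof. exact: (rmorphB (\pi_({ideal_quot P})%qT)). Qed.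
HB.instance Definition _ := GRing.isZmodMorphism.Build D (residue_domain P)
  residue residue_is_zmod_morphism.

Fact residue_is_monoid_morphism : monoid_morphism residue.
Proof.
split; first exact: (rmorph1 (\pi_({ideal_quot P})%qT)).
exact: (rmorphM (\pi_({ideal_quot P})%qT)).
Qed.
HB.instance Definition _ := GRing.isMonoidMorphism.Build D (residue_domain P)
  residue residue_is_monoid_morphism.

Lemma residue_surj (r : residue_domain P) : exists x, residue x = r.
Proof. by exists (repr (r : {ideal_quot P})); rewrite /residue reprK. Qed.

Lemma residue_eq0 x : residue x = 0 <-> divides p x.
Proof.
rewrite -PE; split=> [/eqP|xP].
  rewrite -(rmorph0 residue) /residue.
  by rewrite -(Quotient.idealrBE P) subr0.
by apply/eqP; rewrite -(rmorph0 residue) /residue -(Quotient.idealrBE P) subr0.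
Qed.

Lemma finite_fraction (R : idomainType) :
  finite_set [set: {fraction R}] <-> finite_set [set: R].
Proof.
split=> [fin|fin].
  rewrite -(preimage_setT (@FracField.tofrac R)).
  by apply: finite_preimage fin => x y _ _; apply: tofrac_inj.
apply: sub_finite_set (finite_image2
  (fun a b => @FracField.tofrac R a / @FracField.tofrac R b) fin fin).
move=> c _; have [a [b [b0 bc]]] := fraction_clear c.
by exists a => //; exists b => //; rewrite -bc mulrAC mulfV ?mul1r // tofrac_eq0.
Qed.

(** If some coefficient survived modulo [p], the reduced polynomial would be nonzero with every
    residue as a root, and its size would bound the number of residues. *)
Lemma infinite_residue_vanish (q : {poly D}) :
  infinite_set [set: residue_field P] ->
  (forall a, divides p q.[a]) -> divides p%:P q.
Proof.
move=> inf qa; apply/divides_polyC => i; apply: contrapT => pqi; apply: inf.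
apply/finite_fraction.
have q0 : map_poly residue q != 0.
  apply/eqP => /(congr1 (fun r : {poly residue_domain P} => r`_i)).
  by rewrite coef0 coef_map => /residue_eq0.
have rootq r : root (map_poly residue q) r.
  have [x <-] := residue_surj r; apply/rootP; rewrite horner_map.
  exact/residue_eq0.
apply: contrapT => /(infinite_set_fset (size (map_poly residue q)))[B _ leB].
have := max_poly_roots q0 (introT allP (fun r _ => rootq r)) (finmap.fset_uniq B).
by rewrite ltnNge leB.
Qed.

(** The [u i] represent the nonzero residues. A finite domain is a field, so the class of an [x]
    prime to [p] is singled out by the one [u i] inverse to it; inverses serve as labels because
    [1 - u i * x] is what occurs in the shifted blocks. *)
Lemma residue_representatives : ~ infinite_set [set: residue_field P] ->
  exists (m : nat) (u : 'I_m -> D),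
  [/\ (0 < m)%N, forall i, ~ divides p (u i),
      forall i, exists x, divides p (1 - u i * x)
    & forall x, ~ divides p x ->
        exists i, forall j, divides p (1 - u j * x) <-> j = i].
Proof.
move/contrapT/finite_fraction/finite_seqP => [s0 s0E].
pose R := residue_domain P.
pose s : seq R := undup [seq r <- s0 | r != 0].
have sE (r : R) : (r \in s) = (r != 0).
  have rs0 : [set` s0]%classic r by rewrite -s0E.
  by rewrite mem_undup mem_filter rs0 andbT.
have us : uniq s by apply: undup_uniq.
pose rep (r : R) : D := repr (r : {ideal_quot P}).
have repK (r : R) : residue (rep r) = r by rewrite /residue reprK.
have inv (r : R) : r != 0 -> exists2 y : R, y != 0 & y * r = 1.
  (* Multiplication by [r] maps the finite list [s] of nonzero residues injectively into itself,
     hence onto it, and 1 is attained. *)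
  move=> r0; have uM : uniq [seq y * r | y <- s].
    by rewrite map_inj_uniq //; apply: mulIf.
  have sM : {subset [seq y * r | y <- s] <= s}.
    by move=> _ /mapP[y + ->]; rewrite !sE => y0; rewrite mulf_neq0.
  have [|_ Ms] := uniq_min_size uM sM; first by rewrite size_map.
  have : 1 \in [seq y * r | y <- s] by rewrite Ms sE oner_neq0.
  by case/mapP=> y; rewrite sE => y0 E; exists y.
have sn (i : 'I_(size s)) : nth 0 s i != 0 by rewrite -sE mem_nth.
have div1 a x : divides p (1 - a * x) <-> residue a * residue x = 1.
  rewrite -residue_eq0 rmorphB rmorphM rmorph1; split=> [/eqP|->].
    by rewrite subr_eq0 => /eqP.
  by rewrite subrr.
exists (size s), (fun i => rep (nth 0 s i)); split.
- have : 1 \in s by rewrite sE oner_neq0.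
  by case: (s).
- by move=> i /residue_eq0; rewrite repK; apply/eqP.
- move=> i; have [y y0 yi] := inv _ (sn i); exists (rep y).
  by apply/div1; rewrite !repK mulrC.
move=> x px; have x0 : residue x != 0 by apply/eqP => /residue_eq0.
have [y y0 yx] := inv _ x0.
have ys : (index y s < size s)%N by rewrite index_mem sE.
exists (Ordinal ys) => j; rewrite div1 repK; split=> [jx|->]; last first.
  by rewrite /= nth_index ?sE.
apply/val_inj/eqP; rewrite /= -(nth_uniq 0 (ltn_ord j) ys us) nth_index ?sE //.
by apply/eqP/(mulIf x0); rewrite yx.
Qed.
End Residue.
End Height.

(** * Irreducibility by the Newton polygon *)

Section NewtonPolygon.
Variables (D : idomainType) (D_ufd : is_ufd D) (p : D) (p_prime : prime_elt p).
Implicit Types (f g h : {poly D}) (n w : nat).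
Local Notation K := {fraction D}.
Local Notation tofrac := (@FracField.tofrac D).
Local Notation "f ^K" := (map_poly tofrac f) (at level 2, format "f ^K").
Local Notation exact := (exact_power p).

Lemma exact_power_neq0 a k : exact a k -> a != 0.
Proof.
move=> [m -> pm]; have [p0 _ _] := p_prime; rewrite mulf_neq0 ?expf_neq0 //.
by apply/eqP => m0; apply: pm; rewrite m0; apply: divides0.
Qed.

Lemma exact_power_add a b k : exact a k -> divides (p ^+ k.+1) b ->
  exact (a + b) k.
Proof.
move=> [m -> pm] [c ->]; exists (m + p * c); first by rewrite exprSr; ring.
move=> pmc; apply: pm; rewrite -(addrK (p * c) m).
by apply: divides_sub => //; apply/divides_mulr/dividesxx.
Qed.

Lemma exact_powerX k : exact (p ^+ k) k.
Proof.
exists 1; rewrite ?mulr1 //.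
by have [_ /negP pNu _] := p_prime => /(divides_unit (unitr1 D)).
Qed.

Lemma exact_powerN a k : exact a k -> exact (- a) k.
Proof.
move=> ak; rewrite -mulN1r -[k]add0n; apply: exact_powerM => //.
by apply: exact_power_unit; rewrite ?unitrN ?unitr1.
Qed.

(* The least monomial of least weight, a monomial [a X^i] with [p^l] exactly
   dividing [a] having weight [n l + w i]. *)
Lemma least_weight n w g : g != 0 ->
  exists i k, [/\ exact g`_i k,
    forall j l, exact g`_j l -> (n * k + w * i <= n * l + w * j)%N
  & forall j l, (j < i)%N -> exact g`_j l ->
      (n * k + w * i < n * l + w * j)%N].
Proof.
move=> g0.
pose W N := exists i k, exact g`_i k /\ N = (n * k + w * i)%N.
have exN : exists N, `[< W N >].
  have [|k gk] := exact_power_exists p_prime D_ufd (a := lead_coef g).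
    by rewrite lead_coef_eq0.
  by exists (n * k + w * (size g).-1)%N; apply/asboolP; exists (size g).-1, k.
case: (ex_minnP exN) => N /asboolP[i0 [k0 [gi0 NE]]] minN.
have exi : exists i, `[< exists k, exact g`_i k /\ N = (n * k + w * i)%N >].
  by exists i0; apply/asboolP; exists k0.
case: (ex_minnP exi) => i /asboolP[k [gi NE']] mini.
exists i, k; rewrite -NE'; split=> // j l.
  by move=> gj; apply: minN; apply/asboolP; exists j, l.
move=> ji gj; rewrite ltn_neqAle minN ?andbT; last by apply/asboolP; exists j, l.
apply/eqP => NEj; have : (i <= j)%N by apply: mini; apply/asboolP; exists l.
by rewrite leqNgt ji.
Qed.

(** In the coefficient [i + j], every other term pairs indices [a], [b] with [a < i] or [b < j],
    hence has larger weight. As [a + b = i + j], the index parts of the weights agree, so the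
    [p]-adic value of that term exceeds [k + l]. *)
Lemma least_weight_mul n w g h i j k l : (0 < n)%N ->
  exact g`_i k -> exact h`_j l ->
  (forall a b, exact g`_a b -> (n * k + w * i <= n * b + w * a)%N) ->
  (forall a b, (a < i)%N -> exact g`_a b -> (n * k + w * i < n * b + w * a)%N) ->
  (forall a b, exact h`_a b -> (n * l + w * j <= n * b + w * a)%N) ->
  (forall a b, (a < j)%N -> exact h`_a b -> (n * l + w * j < n * b + w * a)%N) ->
  exact (g * h)`_(i + j) (k + l).
Proof.
move=> n0 gi hj gmin glt hmin hlt.
have ilt : (i < (i + j).+1)%N by rewrite ltnS leq_addr.
rewrite coefM (bigD1 (Ordinal ilt)) //= addKn.
apply: exact_power_add; first exact: exact_powerM.
apply: divides_sum => a ai.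
have [->|ga0] := eqVneq g`_a 0; first by rewrite mul0r; apply: divides0.
have [->|hb0] := eqVneq h`_(i + j - a) 0; first by rewrite mulr0; apply: divides0.
have [s gs] := exact_power_exists p_prime D_ufd ga0.
have [t ht] := exact_power_exists p_prime D_ufd hb0.
apply/(exact_power_divides p_prime _ (exact_powerM p_prime gs ht)).
have ab : (a + (i + j - a) = i + j)%N by have := ltn_ord a; lia.
move: (i + j - a)%N ab ht {hb0} => b ab ht.
rewrite -(ltn_pmul2l n0).
have wE : (w * a + w * b = w * i + w * j)%N by rewrite -!mulnDr ab.
move: ai; rewrite -val_eqE /= neq_ltn => /orP[ai|ia].
  have := glt _ _ ai gs; have := hmin _ _ ht; rewrite !mulnDr.
  by move: wE; clear; lia.
have bj : (b < j)%N by lia.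
have := gmin _ _ gs; have := hlt _ _ bj ht; rewrite !mulnDr.
by move: wE; clear; lia.
Qed.

(* The Newton polygon of [f] is a single segment without interior lattice
   points. *)
Lemma newton_irreducible f n w : (0 < n)%N -> size f = n.+1 -> coprime n w ->
  exact (lead_coef f) 0 -> exact f`_0 w ->
  (forall i k, exact f`_i k -> (n * w <= n * k + w * i)%N) ->
  irreducible_poly f^K.
Proof.
move=> n0 sf nw flead f0 fmin; split; first by rewrite size_tofrac_poly sf.
move=> q q1 qf.
have fn0 : f != 0 by rewrite -size_poly_gt0 sf.
have fK0 : f^K != 0 by rewrite -size_poly_gt0 size_tofrac_poly sf.
have [c [g [c0 gE]]] := clear_denominators q.
have c0K : tofrac c != 0 by rewrite tofrac_eq0.
have sg : size g = size q by rewrite -size_tofrac_poly -gE size_scale.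
have : g^K %| f^K by rewrite -gE dvdpZl.
case/divp_tofrac=> d [h [d0 dfE]].
have dC0 : d%:P != 0 by rewrite polyC_eq0.
have [g0 h0] : g != 0 /\ h != 0.
  by apply/andP; rewrite -negb_or -mulf_eq0 -dfE mulf_neq0.
rewrite -dvdp_size_eqp // size_tofrac_poly -sg sf.
have sgh : ((size g).-1 + (size h).-1 = n)%N.
  have := size_mul g0 h0; rewrite -dfE mul_polyC size_scale // sf.
  by move: g0 h0; rewrite -!size_poly_gt0; lia.
have [e de] := exact_power_exists p_prime D_ufd d0.
have [i [k [gi gmin glt]]] := least_weight n w g0.
have [j [l [hj hmin hlt]]] := least_weight n w h0.
have ghij := least_weight_mul n0 gi hj gmin glt hmin hlt.
have dfij : exact (d * f`_(i + j)) (k + l) by rewrite -coefCM dfE.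
have fij0 : f`_(i + j) != 0.
  by have := exact_power_neq0 dfij; rewrite mulf_eq0 negb_or => /andP[].
have [t ft] := exact_power_exists p_prime D_ufd fij0.
have etE := exact_power_uniq p_prime (exact_powerM p_prime de ft) dfij.
have := fmin _ _ ft => ftmin.
have g0h0 : g`_0 * h`_0 = d * f`_0 by rewrite -coef0M -dfE coefCM.
have ew := exact_powerM p_prime de f0.
have [g00 h00] : g`_0 != 0 /\ h`_0 != 0.
  apply/andP; rewrite -negb_or -mulf_eq0 g0h0; exact: exact_power_neq0 ew.
have [a ga] := exact_power_exists p_prime D_ufd g00.
have [b hb] := exact_power_exists p_prime D_ufd h00.
have abE : (a + b = e + w)%N.
  by apply: (exact_power_uniq p_prime (exact_powerM p_prime ga hb)); rewrite g0h0.
have [g10 h10] : lead_coef g != 0 /\ lead_coef h != 0.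
  by rewrite !lead_coef_eq0.
have [a' ga'] := exact_power_exists p_prime D_ufd g10.
have [b' hb'] := exact_power_exists p_prime D_ufd h10.
have ab'E : (a' + b' = e + 0)%N.
  apply: (exact_power_uniq p_prime (exact_powerM p_prime ga' hb')).
  rewrite -lead_coefM -dfE lead_coefM lead_coefC.
  exact: exact_powerM.
have := gmin _ _ ga; have := hmin _ _ hb.
have := gmin _ _ ga'; have := hmin _ _ hb'.
set dg := (size g).-1 in sgh *; set dh := (size h).-1 in sgh *.
move=> H1 H2 H3 H4.
have wE : (w * dg + w * dh = n * w)%N by rewrite -mulnDr sgh mulnC.
(* The least weights of [g] and [h] add up to at least [n e + n w]. The weights of their constant
   terms add up to exactly this, and so do those of their leading terms; hence all four bounds are
   equalities, and the two ends of [g] have equal weight. *)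
have eqn : (n * a = n * a' + w * dg)%N.
  have : (n * a + n * b = n * e + n * w)%N by rewrite -!mulnDr abE.
  have : (n * a' + n * b' = n * e)%N by rewrite -mulnDr ab'E addn0.
  have : (n * e + n * t = n * k + n * l)%N by rewrite -!mulnDr etE.
  move: ftmin H1 H2 H3 H4 wE; rewrite !muln0 !addn0 mulnDr.
  move: (n * a)%N (n * b)%N (n * a')%N (n * b')%N (n * e)%N (n * t)%N
    (n * k)%N (n * l)%N (w * dg)%N (w * dh)%N (n * w)%N (w * i)%N (w * j)%N.
  by clear; lia.
have : (n %| w * dg)%N.
  rewrite -(dvdn_addr (w * dg) (dvdn_mulr a' (dvdnn n))) -eqn; exact: dvdn_mulr.
(* Now [n] divides the positive degree [dg], so [g] has the full degree [n]. *)
rewrite Gauss_dvdr // => ndg.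
have dg0 : (0 < dg)%N.
  have := size_poly_gt0 g; rewrite g0 /dg -sg in q1 *.
  by case: (size g) q1 => [|[]].
have := dvdn_leq dg0 ndg.
have := size_poly_gt0 g; rewrite g0 /dg in sgh *.
by move: sgh; clear; lia.
Qed.

End NewtonPolygon.

(** * Factorizations and minimal covers *)

Section IrreduciblePolys.
Variable F : fieldType.
Implicit Types (q a b g : {poly F}).

Lemma irreducible_dvdp_or_coprime q a : irreducible_poly q ->
  q %| a \/ coprimep q a.
Proof.
move=> [_ qP]; have [|g1] := boolP (coprimep q a); first by right.
left; rewrite -(eqp_dvdl _ (qP _ g1 (dvdp_gcdl q a))); exact: dvdp_gcdr.
Qed.

Lemma irreducible_dvdp_mul q a b : irreducible_poly q -> q %| a * b ->
  q %| a \/ q %| b.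
Proof.
move=> irrq; have [qa|cop] := irreducible_dvdp_or_coprime a irrq; first by left.
by rewrite Gauss_dvdpr //; right.
Qed.

Lemma irreducible_not_dvdp1 q : irreducible_poly q -> ~~ (q %| 1).
Proof. by move=> [q1 _]; rewrite dvdp1; case: (size q) q1 => [|[]]. Qed.

Lemma irreducible_dvdp_prod (T : eqType) q (t : seq T) (G : T -> {poly F}) :
  irreducible_poly q -> q %| \prod_(h <- t) G h -> exists2 h, h \in t & q %| G h.
Proof.
move=> irrq; elim: t => [|h t IHt].
  by rewrite big_nil (negPf (irreducible_not_dvdp1 irrq)).
rewrite big_cons => /(irreducible_dvdp_mul irrq)[qh|/IHt[k kt qk]].
  by exists h => //; apply: mem_head.
by exists k => //; rewrite inE kt orbT.
Qed.

(** Each [G j] in turn either divides [g] and is cancelled, or is coprime to [g] and is dropped from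
    the product. *)
Lemma dvdp_prod_subset (J : finType) (G : J -> {poly F}) (S : {set J}) g :
  (forall j, irreducible_poly (G j)) -> g %| \prod_(j in S) G j ->
  exists2 I : {set J}, I \subset S & g %= \prod_(j in I) G j.
Proof.
move=> irrG; have [m] := ubnP #|S|; elim: m S g => [//|m IHm] S g Sm gS.
have [S0|[j jS]] := set_0Vmem S.
  exists finset.set0; rewrite ?finset.sub0set // big_set0.
    by move: gS; rewrite S0 big_set0 dvdp1 size_poly_eq1.
have Sj : (#|S :\ j| < m)%N by rewrite (cardsD1 j) jS in Sm.
move: gS; rewrite (big_setD1 j) //=.
have [/dvdpP[g' ->]|cop] := irreducible_dvdp_or_coprime g (irrG j).
  have Gj0 := irredp_neq0 (irrG j).
  rewrite mulrC dvdp_mul2l // => /(IHm _ _ Sj)[I IS g'I].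
  exists (j |: I).
    by rewrite finset.subUset finset.sub1set jS (fintype.subset_trans IS) ?subD1set.
  rewrite big_setU1; first by rewrite /= eqp_mul2l.
  by apply/negP => /(fintype.subsetP IS); rewrite !inE eqxx.
rewrite Gauss_dvdpr 1?coprimep_sym // => /(IHm _ _ Sj)[I IS gI].
by exists I => //; apply: fintype.subset_trans IS (subD1set _ _).
Qed.
End IrreduciblePolys.

(** * Integer-valued polynomials with a unit value at 0 *)

Section UnitAtZero.
Variable D : idomainType.
Implicit Types f g : Int D.
Local Notation K := {fraction D}.
Local Notation tofrac := (@FracField.tofrac D).

(** Constants of this kind are units, and the property passes to divisors, so no nonunit constant
    can occur in a factorization of such an element. *)
Definition unit_at0 f : Prop :=
  exists2 b, b \is a GRing.unit & (Int_poly f).[0] = tofrac b.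

Lemma unit_at0M f g : unit_at0 f -> unit_at0 g -> unit_at0 (f * g).
Proof.
move=> [b bU fb] [c cU gc]; exists (b * c); rewrite ?unitrM ?bU //.
by rewrite Int_polyM hornerM fb gc -rmorphM.
Qed.

Lemma unit_at0_divides f g : divides g f -> unit_at0 f -> unit_at0 g.
Proof.
move=> [h ->] [b bU].
have [c] := Int_poly_valued g 0; have [d] := Int_poly_valued h 0.
rewrite tofrac0 Int_polyM hornerM => -> gc; rewrite gc -rmorphM.
by move=> /tofrac_inj cdb; exists c => //; move: bU; rewrite -cdb unitrM => /andP[].
Qed.

Lemma unit_at0_prod (I : Type) (r : seq I) (P : pred I) (G : I -> Int D) :
  (forall i, P i -> unit_at0 (G i)) -> unit_at0 (\prod_(i <- r | P i) G i).
Proof.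
move=> G0; apply: big_ind => //; last exact: unit_at0M.
by exists 1; rewrite ?unitr1 // Int_poly1 hornerC rmorph1.
Qed.

Lemma Int_unit_size f : f \is a GRing.unit -> size (Int_poly f) = 1.
Proof.
move=> /unitrPr[g /(congr1 (@Int_poly D))]; rewrite Int_polyM Int_poly1 => fg.
by apply/eqP; rewrite -dvdp1 -fg dvdp_mulIl.
Qed.

Lemma Int_set_const (a : D) : Int_set D (tofrac a)%:P.
Proof. by move=> x; exists a; rewrite hornerC. Qed.

Lemma Int_const_unit (a : D) : a \is a GRing.unit ->
  mk_Int (Int_set_const a) \is a GRing.unit.
Proof.
move=> aU; apply/unitrPr; exists (mk_Int (Int_set_const a^-1)).
apply: Int_poly_inj; rewrite Int_polyM !mk_IntK Int_poly1 -polyCM -rmorphM.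
by rewrite mulrV // rmorph1.
Qed.

Lemma unit_at0_unit f : size (Int_poly f) = 1 -> unit_at0 f ->
  f \is a GRing.unit.
Proof.
move=> s1 [b bU fb]; have fC := size1_polyC (eq_leq s1).
rewrite [f](_ : _ = mk_Int (Int_set_const b)); first exact: Int_const_unit.
by apply: Int_poly_inj; rewrite mk_IntK -fb fC hornerC.
Qed.

Lemma unit_at0_neq0 f : unit_at0 f -> Int_poly f != 0.
Proof.
move=> [b bU fb]; apply: contraTneq bU => f0; move: fb; rewrite f0 horner0.
by rewrite -(rmorph0 tofrac) => /tofrac_inj <-; rewrite unitr0.
Qed.

(** Evaluation at 0 shows that the constant of proportionality over [K] is a quotient of two units
    of [D]. *)
Lemma unit_at0_associated f g : unit_at0 f -> unit_at0 g ->
  Int_poly f %= Int_poly g -> associated f g.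
Proof.
move=> f0 g0 /eqp_eq fg; have := unit_at0_neq0 g0; rewrite -lead_coef_eq0 => lg.
have [b bU fb] := f0; have [c cU gc] := g0.
exists (mk_Int (Int_set_const (b / c))).
  by rewrite Int_const_unit // unitrM unitrV bU.
apply: Int_poly_inj; rewrite Int_polyM mk_IntK mul_polyC.
have {}fg : Int_poly f = (lead_coef (Int_poly f) / lead_coef (Int_poly g)) *: Int_poly g.
  by apply: (scalerI lg); rewrite fg scalerA mulrC divfK.
have c0 : tofrac c != 0 by rewrite tofrac_eq0; apply: contraTneq cU => ->; rewrite unitr0.
move: fb; rewrite fg hornerZ gc => E; congr (_ *: _).
by apply: (mulIf c0); rewrite E -rmorphM divrK.
Qed.

Lemma associated_eqp f g : associated f g -> Int_poly f %= Int_poly g.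
Proof.
move=> [a aU ->]; rewrite Int_polyM -[X in _ %= X]mul1r eqp_mulr //.
by rewrite -size_poly_eq1 (Int_unit_size aU).
Qed.
End UnitAtZero.

(** * Factorizations of a product whose denominator stays with one factor *)

Section Covers.
Variables (D : idomainType) (J : finType) (k : nat).
Local Notation K := {fraction D}.
Local Notation tofrac := (@FracField.tofrac D).
Local Notation "f ^K" := (map_poly tofrac f) (at level 2, format "f ^K").
Variables (d e : D) (Q0 : {poly D}) (Q : J -> {poly D}) (C : 'I_k -> {set J}).
Hypotheses (d0 : d != 0) (eU : e \is a GRing.unit) (k0 : (0 < k)%N).
Hypotheses (Q0_0 : Q0.[0] = e * d) (Q_0 : forall j, (Q j).[0] = 1).
Hypotheses (irrQ0 : irreducible_poly Q0^K)
  (irrQ : forall j, irreducible_poly (Q j)^K).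
Hypotheses (copQ0 : forall j, coprimep Q0^K (Q j)^K)
  (copQ : forall i j, i != j -> coprimep (Q i)^K (Q j)^K).
(** [I] collects the [Q j] kept with [Q0], so the [C i] are the largest sets of factors that can be
    split off while the rest still absorbs [d]. *)
Hypothesis coverP : forall I : {set J},
  (forall x, divides d (Q0.[x] * \prod_(j in I) (Q j).[x])) <->
  (exists i, ~: I \subset C i).
Hypothesis antichain : forall i j, C i \subset C j -> i = j.

Let d0K : tofrac d != 0. Proof. by rewrite tofrac_eq0. Qed.
Let PQ (I : {set J}) := Q0^K * \prod_(j in I) (Q j)^K.
Let q j := mk_Int (Int_set_base (Q j)).

Let horner_PQ I x :
  (PQ I).[tofrac x] = tofrac (Q0.[x] * \prod_(j in I) (Q j).[x]).
Proof.
rewrite hornerM horner_prod horner_map rmorphM rmorph_prod; congr (_ * _).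
by apply: eq_bigr => j _; rewrite horner_map.
Qed.

Let prod_at0 (I : {set J}) : \prod_(j in I) (Q j).[0] = 1.
Proof. by rewrite big1. Qed.

Let PQ_neq0 (I : {set J}) : PQ I != 0.
Proof.
apply: mulf_neq0; first exact: irredp_neq0.
rewrite prodf_seq_neq0.
by apply/allP => j _; apply/implyP => _; apply: irredp_neq0.
Qed.

Lemma block_Int_set I : (exists i, ~: I \subset C i) ->
  Int_set D ((tofrac d)^-1 *: PQ I).
Proof.
move=> /coverP dI x; have [y yE] := dI x; exists y.
by rewrite hornerZ horner_PQ yE rmorphM mulKf.
Qed.
Let E I cI := mk_Int (@block_Int_set I cI).

(** At 0 the product over [I] is 1 and [d] cancels against [Q0.[0] = e * d], leaving [e]. *)
Lemma block_unit_at0 I cI : unit_at0 (@E I cI).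
Proof.
exists e => //; rewrite mk_IntK -(rmorph0 tofrac) hornerZ horner_PQ Q0_0 prod_at0.
by rewrite mulr1 mulrC rmorphM mulfK.
Qed.

Lemma block_eqp I cI : Int_poly (@E I cI) %= PQ I.
Proof. by rewrite mk_IntK eqp_scale // invr_eq0. Qed.

Lemma atom_unit_at0 j : unit_at0 (q j).
Proof.
exists 1; rewrite ?unitr1 // mk_IntK -(rmorph0 tofrac) horner_map.
by rewrite /= Q_0 rmorph1.
Qed.

Lemma atom_nonunit j : q j \isn't a GRing.unit.
Proof.
apply/negP => /Int_unit_size; rewrite mk_IntK.
by have [+ _] := irrQ j => /[swap] ->.
Qed.

(** Over [K] one of two factors is constant; as a divisor of [q j] it has a unit value at 0, so it
    is a unit. *)
Lemma atom_irreducible j : irreducible_elt (q j).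
Proof.
split; last 1 first.
- move=> a b qE.
  have aq : divides a (q j) by rewrite qE; apply/divides_mulr/dividesxx.
  have bq : divides b (q j) by rewrite qE; apply/divides_mull/dividesxx.
  have a0 := unit_at0_divides aq (atom_unit_at0 j).
  have b0 := unit_at0_divides bq (atom_unit_at0 j).
  have QE : (Q j)^K = Int_poly a * Int_poly b by rewrite -Int_polyM -qE.
  have [a1|a1] := eqVneq (size (Int_poly a)) 1.
    by left; apply: unit_at0_unit.
  right; apply: unit_at0_unit => //.
  have := irrQ j _ a1; rewrite {1}QE dvdp_mulIl => /(_ isT) /eqp_size.
  rewrite QE size_mul ?unit_at0_neq0 //.
  have := unit_at0_neq0 a0; have := unit_at0_neq0 b0.
  by rewrite -!size_poly_gt0; move: (size _) (size _) => x y; lia.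
- apply: contraNneq (unit_at0_neq0 (atom_unit_at0 j)) => ->.
  by rewrite Int_poly0.
- exact: atom_nonunit.
Qed.

(** An irreducible [h] in [t] is, up to a constant, a product over a nonempty [I]. Splitting off one
    [j] of [I] makes the rest a unit, so [h] is associated to [q j] and both can be removed. *)
Lemma atoms_essentially_same t (S : {set J}) :
  (forall h, h \in t -> irreducible_elt h /\ unit_at0 h) ->
  \prod_(h <- t) Int_poly h %= \prod_(j in S) (Q j)^K ->
  essentially_same t [seq q j | j <- enum S].
Proof.
elim: t S => [|h t IHt] S Ht.
  rewrite big_nil; have [->|[j jS]] := set_0Vmem S.
    by rewrite enum_set0 => _; apply: essentially_same_nil.
  rewrite (big_setD1 j) //= => E1; have := irreducible_not_dvdp1 (irrQ j).
  by rewrite (eqp_dvdr _ E1) dvdp_mulIl.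
rewrite big_cons => tS; have [irrh h0] := Ht h (mem_head _ _).
have [I IS hI] : exists2 I : {set J}, I \subset S &
    Int_poly h %= \prod_(j in I) (Q j)^K.
  by apply: dvdp_prod_subset => //; rewrite -(eqp_dvdr _ tS) dvdp_mulIl.
have [I0|[j jI]] := set_0Vmem I.
  have [_ /negP[]] := irrh; apply: unit_at0_unit => //.
  by rewrite (eqp_size hI) I0 big_set0 size_poly1.
pose r := \prod_(i in I :\ j) q i.
have r0 : unit_at0 r by apply: unit_at0_prod => i _; apply: atom_unit_at0.
have hqr : associated (q j * r) h.
  apply: unit_at0_associated => //; first exact/unit_at0M/r0/atom_unit_at0.
  rewrite eqp_sym Int_polyM Int_poly_prod; move: hI.
  by rewrite (big_setD1 j).
have rU : r \is a GRing.unit.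
  have [_ _ /(_ _ _ erefl)[|//]] := irreducible_assoc hqr irrh.
  by rewrite (negPf (atom_nonunit j)).
have qh : associated (q j) h.
  apply: associated_trans hqr; exists r^-1; rewrite ?unitrV //.
  by rewrite mulrCA mulVr ?mulr1.
have jS := fintype.subsetP IS _ jI.
have Pqh : Int_poly h %= (Q j)^K by rewrite eqp_sym; apply: associated_eqp qh.
apply: essentially_same_permr (_ : perm_eq (q j :: [seq q i | i <- enum (S :\ j)]) _) _.
  rewrite -[_ :: _]/(map q (j :: enum (S :\ j))); apply: perm_map.
  apply: uniq_perm; rewrite /= ?enum_uniq ?andbT // ?mem_enum ?inE ?eqxx //.
  move=> i; rewrite inE !mem_enum !inE; case: eqP => [->|//]; by rewrite jS.
apply: essentially_same_cons => //; apply: IHt.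
  by move=> l lt; apply: Ht; rewrite inE lt orbT.
rewrite -(eqp_mul2l _ _ (irredp_neq0 (irrQ j))) -(big_setD1 j) //=.
by apply: eqp_trans tS; rewrite eqp_mulr // eqp_sym.
Qed.

(** The constant relating [h] to [PQ I] is read off at 0: it is [e * d / b] with [b] a unit, so [d]
    divides every value of [PQ I]. *)
Lemma block_of_divisor (h : Int D) (S : {set J}) : unit_at0 h ->
  Q0^K %| Int_poly h -> Int_poly h %| PQ S ->
  exists I : {set J}, [/\ I \subset S, Int_poly h %= PQ I
    & exists i, ~: I \subset C i].
Proof.
have Q00 := irredp_neq0 irrQ0.
move=> h0 /dvdpP[g hE]; rewrite hE mulrC dvdp_mul2l //.
case/(dvdp_prod_subset irrQ)=> I IS gI; exists I; split=> //.
  by rewrite eqp_mul2l.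
have hI : PQ I %= Int_poly h by rewrite hE mulrC eqp_sym eqp_mul2l.
have hN0 := unit_at0_neq0 h0.
have lh : lead_coef (Int_poly h) != 0 by rewrite lead_coef_eq0.
pose c := lead_coef (PQ I) / lead_coef (Int_poly h).
have PQE : PQ I = c *: Int_poly h.
  by apply: (scalerI lh); rewrite (eqp_eq hI) scalerA /c mulrC divfK.
have [b bU hb] := h0.
have b0 : tofrac b != 0.
  by rewrite tofrac_eq0; apply: contraTneq bU => ->; rewrite unitr0.
have cE : c = tofrac (e * d / b).
  apply: (mulIf b0); rewrite -rmorphM divrK // -[LHS](_ : (PQ I).[0] = _).
    by rewrite -(rmorph0 tofrac) horner_PQ Q0_0 prod_at0 mulr1.
  by rewrite PQE hornerZ hb.
apply/coverP => x; have [y hy] := Int_poly_valued h x.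
exists (e / b * y); apply: tofrac_inj; rewrite -horner_PQ PQE hornerZ hy cE.
by rewrite -rmorphM; congr (tofrac _); ring.
Qed.

Let cC i : exists i', ~: ~: C i \subset C i'.
Proof. by exists i; rewrite finset.setCK. Qed.

(** The factor carrying [Q0] is, up to a constant, [PQ I] for some [I] inside [~: C i] that still
    absorbs [d]. The antichain condition forces [I = ~: C i], so the other factor is constant, hence
    a unit. *)
Lemma block_irreducible i : irreducible_elt (E (cC i)).
Proof.
have E0 := block_unit_at0 (cC i); have EN0 := unit_at0_neq0 E0.
have half a b : E (cC i) = a * b -> Q0^K %| Int_poly a -> b \is a GRing.unit.
  move=> EE Qa.
  have aE : divides a (E (cC i)) by rewrite EE; apply/divides_mulr/dividesxx.
  have bE : divides b (E (cC i)) by rewrite EE; apply/divides_mull/dividesxx.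
  have a0 := unit_at0_divides aE E0; have b0 := unit_at0_divides bE E0.
  have PE : PQ (~: C i) %= Int_poly a * Int_poly b.
    by rewrite -Int_polyM -EE eqp_sym block_eqp.
  have [|I [IS aI [i' ii']]] := block_of_divisor a0 Qa (S := ~: C i).
    by rewrite (eqp_dvdr _ PE) dvdp_mulIl.
  have CI : C i \subset ~: I by rewrite -(finset.setCK (C i)) finset.setCS.
  have ii : i = i' by apply/antichain/(fintype.subset_trans CI).
  have {}IS : I = ~: C i.
    by apply/eqP; rewrite finset.eqEsubset IS /= -(finset.setCK I) finset.setCS ii.
  apply: unit_at0_unit => //; move/eqp_size: PE; rewrite -IS -(eqp_size aI).
  rewrite size_mul ?unit_at0_neq0 //.
  have := unit_at0_neq0 a0; have := unit_at0_neq0 b0.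
  by rewrite -!size_poly_gt0; move: (size _) (size _) => x y; lia.
split.
- by apply: contraNneq EN0 => ->; rewrite Int_poly0.
- apply/negP => /Int_unit_size/eqP; rewrite (eqp_size (block_eqp _)).
  rewrite -dvdp1 => PQ1; have := irreducible_not_dvdp1 irrQ0.
  by rewrite (dvdp_trans _ PQ1) // dvdp_mulIl.
move=> a b EE; have /irreducible_dvdp_mul : Q0^K %| Int_poly a * Int_poly b.
  by rewrite -Int_polyM -EE (eqp_dvdr _ (block_eqp _)) dvdp_mulIl.
case/(_ irrQ0)=> [Qa|Qb]; first by right; apply: (half a b).
by left; apply: (half b a) => //; rewrite mulrC.
Qed.

(** [H] is the full product divided by [d]; the factorization [s i] splits off the [Q j] with [j] in
    [C i] and keeps the others with [Q0] in one block. *)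
Lemma covers_factorizations : exists (H : Int D) (s : 'I_k -> seq (Int D)),
  [/\ forall i, factorization H (s i),
      forall i, size (s i) = #|C i|.+1,
      forall i j, i != j -> ~ essentially_same (s i) (s j)
    & forall t, factorization H t -> exists i, essentially_same t (s i)].
Proof.
have cT : exists i, ~: [set: J] \subset C i.
  by exists (Ordinal k0); rewrite finset.setCT finset.sub0set.
pose s i := E (cC i) :: [seq q j | j <- enum (C i)].
exists (E cT), s; split.
- move=> i; split.
    move=> a; rewrite inE => /predU1P[->|/mapP[j _ ->]].
      exact: block_irreducible.
    exact: atom_irreducible.
  apply: Int_poly_inj; rewrite big_cons big_map Int_polyM Int_poly_prod.
  rewrite big_enum /= -scalerAl -mulrA; congr (_ *: (_ * _)).
  rewrite mulrC (big_setID (C i)) /= finset.setTI finset.setTD; congr (_ * _).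
- by move=> i; rewrite /= size_map -cardE.
(* Each [q x] with [x] in [C i] has an associate in [s j]. It is not the block, whose divisor [Q0]
   is coprime to [Q x], and distinct atoms are coprime, so [x] lies in [C j]. *)
- move=> i j ij ssij; move/eqP: ij; apply; apply: antichain.
  apply/fintype.subsetP => x xC.
  have [|y] := essentially_same_mem ssij (x := q x).
    by rewrite inE map_f ?orbT // mem_enum.
  move=> ys /associated_eqp yE.
  move: ys; rewrite inE => /predU1P[yb|/mapP[x' x'C yx']].
    have := dvdp_mulIl Q0^K (\prod_(l in ~: C j) (Q l)^K).
    rewrite -(eqp_dvdr _ (block_eqp (cC j))) -yb (eqp_dvdr _ yE) => Q0x.
    have := irreducible_not_dvdp1 irrQ0.
    by rewrite dvdp1 -coprimepp (coprimep_dvdl Q0x (copQ0 x)).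
  have [<-|xx'] := eqVneq x' x; first by rewrite mem_enum in x'C.
  have := irreducible_not_dvdp1 (irrQ x'); rewrite dvdp1 -coprimepp.
  rewrite (coprimep_dvdl _ (copQ xx')) //.
  by move: yE; rewrite yx' mk_IntK => /eqp_dvdr <-.
move=> t [irrt HE].
have t0 h : h \in t -> unit_at0 h.
  move=> ht; apply: unit_at0_divides (block_unit_at0 cT).
  by rewrite HE; apply: divides_prod_mem.
have tE : \prod_(h <- t) Int_poly h %= PQ [set: J].
  by rewrite -Int_poly_prod -HE block_eqp.
have [h ht Q0h] : exists2 h, h \in t & Q0^K %| Int_poly h.
  by apply: irreducible_dvdp_prod => //; rewrite (eqp_dvdr _ tE) dvdp_mulIl.
have h0 := t0 h ht.
have [|I [_ hI cI]] := block_of_divisor h0 Q0h (S := [set: J]).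
  by rewrite -(eqp_dvdr _ tE) (big_rem h) //= dvdp_mulIl.
have hEI : associated (E cI) h.
  apply: unit_at0_associated => //; first exact: block_unit_at0.
  by apply: eqp_trans (block_eqp cI) _; rewrite eqp_sym.
have [i Ii] := cI; exists i.
(* Were some [j] of [I] in [C i], the block on [I :\ j] would still be integer-valued and [q j]
   would split off from the irreducible [h]. *)
have IE : I = ~: C i.
  apply/eqP; rewrite eq_sym finset.eqEsubset -{1}(finset.setCK I) finset.setCS Ii /=.
  apply/fintype.subsetP => j jI; rewrite inE; apply/negP => jC.
  have cIj : exists i, ~: (I :\ j) \subset C i.
    by exists i; rewrite finset.setCD finset.subUset Ii finset.sub1set.
  have EIj : E cI = E cIj * q j.
    apply: Int_poly_inj; rewrite Int_polyM !mk_IntK -scalerAl; congr (_ *: _).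
    by rewrite /PQ (big_setD1 j) //=; ring.
  have [_ _ /(_ _ _ EIj)[]] := irreducible_assoc hEI (irrt h ht).
    move/Int_unit_size/eqP; rewrite (eqp_size (block_eqp _)) -dvdp1 => PQ1.
    have := irreducible_not_dvdp1 irrQ0.
    by rewrite (dvdp_trans _ PQ1) // dvdp_mulIl.
  by rewrite (negPf (atom_nonunit j)).
apply: (essentially_same_perml (s := h :: rem h t)).
  by rewrite perm_sym perm_to_rem.
apply: essentially_same_cons.
  apply: associated_trans hEI; apply: unit_at0_associated; try exact: block_unit_at0.
  apply: eqp_trans (block_eqp _) _; rewrite -IE eqp_sym; exact: block_eqp.
apply: atoms_essentially_same.
  by move=> l /mem_rem lt; split; [apply: irrt | apply: t0].
rewrite -(eqp_mul2l _ _ (PQ_neq0 I)).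
apply: (@eqp_trans _ (PQ [set: J])).
  apply: eqp_trans tE; rewrite [X in _ %= X](big_rem h) //=.
  by rewrite eqp_mulr // eqp_sym.
rewrite IE /PQ -mulrA eqp_mul2l ?irredp_neq0 //.
by rewrite mulrC (big_setID (C i)) /= finset.setTI finset.setTD eqpxx.
Qed.

End Covers.

(** * The building blocks *)

(** The inverse substitution [M] carries a divisor of the composite back to a divisor of [f] of the
    same size. *)
Lemma irreducible_comp_affine (F : fieldType) (f : {poly F}) (a b : F) :
  a != 0 -> irreducible_poly f -> irreducible_poly (f \Po (a *: 'X + b%:P)).
Proof.
move=> a0 irrf; have [f1 fP] := irrf.
have sL (c d : F) : c != 0 -> size (c *: 'X + d%:P) = 2.
  move=> c0; rewrite size_polyDl size_scale ?size_polyX //.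
  by rewrite ltnS size_polyC leq_b1.
set L := _ + _; pose M := a^-1 *: 'X + (- (a^-1 * b))%:P.
have sM : size M = 2 by rewrite sL // invr_eq0.
have LM : L \Po M = 'X.
  rewrite /L /M comp_polyD comp_polyZ comp_polyX comp_polyC scalerDr scalerA.
  rewrite mulfV // scale1r -mul_polyC -polyCM -addrA -polyCD mulrN mulrA mulfV //.
  by rewrite mul1r addNr addr0.
split=> [|g g1 gf]; first by rewrite size_comp_poly2 // sL.
have : g \Po M %| f.
  by rewrite -[f]comp_polyXr -LM comp_polyA; apply: dvdp_comp_poly.
move=> /fP; rewrite size_comp_poly2 // => /(_ g1) /eqp_size.
rewrite size_comp_poly2 // => gs.
by rewrite -dvdp_size_eqp // size_comp_poly2 ?sL // gs.
Qed.

Section Blocks.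
Variables (D : idomainType) (D_ufd : is_ufd D) (p : D) (p_prime : prime_elt p).
Local Notation tofrac := (@FracField.tofrac D).
Local Notation "f ^K" := (map_poly tofrac f) (at level 2, format "f ^K").
Local Notation exact := (exact_power p).
Implicit Types (u x : D) (n w : nat).

Definition center_block n w : {poly D} := 'X^n - (p ^+ w)%:P.

(* The subtracted term is [p^w 'X] rather than [p^w] so that the value at [0]
   is [1]. *)
Definition shifted_block u n w : {poly D} :=
  (1 - u%:P * 'X) ^+ n - (p ^+ w)%:P * 'X.

Lemma size_center_block n w : (0 < n)%N -> size (center_block n w) = n.+1.
Proof.
move=> n0; rewrite size_polyDl size_polyXn // size_polyN size_polyC.
by rewrite ltnS (leq_trans (leq_b1 _)).
Qed.

Lemma center_block0 n w : (0 < n)%N -> (center_block n w).[0] = - 1 * p ^+ w.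
Proof. by case: n => // n _; rewrite !hornerE expr0n /= sub0r mulN1r. Qed.

(** Only the two end coefficients are nonzero, so the Newton polygon is the segment from [(0, w)] to
    [(n, 0)]. *)
Lemma center_block_irreducible n w : (0 < n)%N -> coprime n w ->
  irreducible_poly (center_block n w)^K.
Proof.
move=> n0 nw; have s := size_center_block w n0.
have coefB i : (center_block n w)`_i =
    (if i == n then 1 else 0) - (if i == 0%N then p ^+ w else 0).
  by rewrite coefB coefXn coefC; case: eqP.
apply: (newton_irreducible D_ufd p_prime n0 s nw).
- rewrite lead_coefE s coefB eqxx; case: (n) n0 => // m _; rewrite subr0.
  exact/exact_power_unit/unitr1.
- rewrite coefB; case: (n) n0 => // m _; rewrite sub0r.
  exact/exact_powerN/exact_powerX.
move=> i k; rewrite coefB; have [->|ni] := eqVneq i n; first by rewrite mulnC; lia.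
have [->|i0] := eqVneq i 0%N.
  rewrite sub0r => /exact_power_uniq -/(_ p_prime w) <-; first by rewrite leq_addr.
  exact/exact_powerN/exact_powerX.
by rewrite subr0 => /exact_power_neq0 -/(_ p_prime); rewrite eqxx.
Qed.

Lemma center_block_in n w x : (w < n)%N -> divides p x ->
  exact (center_block n w).[x] w.
Proof.
move=> wn [y ->]; rewrite !hornerE addrC.
apply: exact_power_add; first exact/exact_powerN/exact_powerX.
exists (p ^+ (n - w.+1) * y ^+ n).
by rewrite mulrA -exprD subnKC // exprMn.
Qed.

Lemma prime_dividesX x n : divides p (x ^+ n) -> divides p x.
Proof.
have [_ /negP pNu pP] := p_prime.
elim: n => [|n IHn]; first by rewrite expr0 => /(divides_unit (unitr1 D)).
by rewrite exprS => /pP[].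
Qed.

Lemma center_block_out n w x : (0 < w)%N -> ~ divides p x ->
  exact (center_block n w).[x] 0.
Proof.
move=> w0 px; rewrite !hornerE.
apply: exact_power_add; first by apply: exact_power0 => /prime_dividesX.
by exists (- p ^+ w.-1); rewrite expr1 mulrN -exprS prednK.
Qed.

Lemma size_shifted_block u n w : u != 0 -> (1 < n)%N ->
  size (shifted_block u n w) = n.+1.
Proof.
move=> u0 n1.
have s2 : size (1 - u%:P * 'X) = 2.
  rewrite addrC mul_polyC size_polyDl size_polyN size_scale ?size_polyX //.
  by rewrite size_poly1.
have sn : size ((1 - u%:P * 'X) ^+ n) = n.+1.
  have := size_exp (1 - u%:P * 'X) n; rewrite s2 mul1n.
  case: (size _) => [|m] /=; last by move=> ->.
  by move=> n0; rewrite -n0 in n1.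
rewrite size_polyDl sn // size_polyN mul_polyC (leq_ltn_trans (size_scale_leq _ _)) //.
by rewrite size_polyX.
Qed.

Lemma shifted_block0 u n w : (shifted_block u n w).[0] = 1.
Proof. by rewrite !hornerE ?mulr0 ?subr0 expr1n. Qed.

Lemma shifted_block_irreducible u n w : ~ divides p u -> (1 < n)%N ->
  coprime n w -> irreducible_poly (shifted_block u n w)^K.
Proof.
move=> pu n1 nw; have n0 : (0 < n)%N := ltnW n1.
have u0 : u != 0 by apply/eqP => u0; apply: pu; rewrite u0; apply: divides0.
(* With [Y = 1 - u X], the block times [u] becomes [u Y^n + p^w Y - p^w], which is [f] in [Y]; its
   linear term has value [w] and lies above the segment from [(0, w)] to [(n, 0)]. *)
pose f := u *: 'X^n + (p ^+ w) *: 'X - (p ^+ w)%:P.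
have coefF i : f`_i = (if i == n then u else 0) +
    (if i == 1%N then p ^+ w else 0) - (if i == 0%N then p ^+ w else 0).
  rewrite coefB coefD !coefZ coefXn coefX coefC.
  by congr (_ + _ - _); [case: (i == n) | case: (i == 1%N)];
    rewrite ?mulr1 ?mulr0.
have sf : size f = n.+1.
  rewrite /f -addrA size_polyDl size_scale ?size_polyXn //.
  rewrite (leq_ltn_trans (size_polyD _ _)) // gtn_max size_polyN size_polyC.
  rewrite (leq_ltn_trans (size_scale_leq _ _)) ?size_polyX //=.
  by rewrite (leq_ltn_trans (leq_b1 _)).
have irrf : irreducible_poly f^K.
  apply: (newton_irreducible D_ufd p_prime n0 sf nw).
  - rewrite lead_coefE sf coefF eqxx; case: (n) n1 => [|[|m]] //= _.
    by rewrite addr0 subr0; apply: exact_power0.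
  - rewrite coefF; case: (n) n1 => [|[|m]] //= _; rewrite !add0r.
    exact/exact_powerN/exact_powerX.
  move=> i k; rewrite coefF.
  have [->|ni] := eqVneq i n; first by rewrite mulnC; lia.
  case: i ni => [|[|i]] _ /=.
  - rewrite !add0r => /exact_power_uniq -/(_ p_prime w) <-; first by rewrite leq_addr.
    exact/exact_powerN/exact_powerX.
  - rewrite add0r subr0 => /exact_power_uniq -/(_ p_prime w) <-.
      by rewrite leq_addr.
    exact: exact_powerX.
  by rewrite subr0 addr0 => /exact_power_neq0 -/(_ p_prime); rewrite eqxx.
have uK : tofrac u != 0 by rewrite tofrac_eq0.
have E : tofrac u *: (shifted_block u n w)^K =
    f^K \Po ((- tofrac u) *: 'X + 1%:P).
  rewrite -map_polyZ /= (_ : _ + _ = (1 - u%:P * 'X)^K); last first.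
    rewrite rmorphB rmorphM /= !map_polyC map_polyX /= rmorph1.
    by rewrite mul_polyC scaleNr addrC.
  rewrite -map_comp_poly; congr (_ ^K).
  rewrite /f comp_polyB comp_polyD !comp_polyZ comp_polyX comp_polyC comp_Xn_poly.
  rewrite /shifted_block -!mul_polyC.
  by move: ((1 - u%:P * 'X) ^+ n) (p ^+ w)%:P u%:P => a b c; ring.
have irrc : irreducible_poly (f^K \Po ((- tofrac u) *: 'X + 1%:P)).
  by apply: irreducible_comp_affine; rewrite ?oppr_eq0.
move: irrc; rewrite -E => -[s1 sP]; split; first by move: s1; rewrite size_scale.
move=> q q1 qs; apply: eqp_trans (eqp_scale _ uK); apply: sP => //.
by rewrite dvdpZr.
Qed.

(** Here [x] is prime to [p], so [p^w x] has value exactly [w], while [w < n] gives the power of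
    [1 - u x] a larger one. *)
Lemma shifted_block_in u n w x : (w < n)%N -> divides p (1 - u * x) ->
  exact (shifted_block u n w).[x] w.
Proof.
move=> wn ux; rewrite !hornerE addrC.
apply: exact_power_add.
  apply: exact_powerN => //; rewrite -[X in exact_power _ _ X]addn0.
  apply: exact_powerM => //; first exact: exact_powerX.
  apply: exact_power0 => px; have [_ /negP pNu _] := p_prime; apply: pNu.
  apply: (divides_unit (unitr1 D)); rewrite -(subrK (u * x) 1).
  exact/divides_add/divides_mull.
have [y ->] := ux; exists (p ^+ (n - w.+1) * y ^+ n).
by rewrite mulrA -exprD subnKC // exprMn.
Qed.

Lemma shifted_block_out u n w x : (0 < w)%N -> ~ divides p (1 - u * x) ->
  exact (shifted_block u n w).[x] 0.
Proof.
move=> w0 px; rewrite !hornerE.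
apply: exact_power_add; first by apply: exact_power0 => /prime_dividesX.
by exists (- (p ^+ w.-1 * x)); rewrite expr1 mulrN mulrA -exprS prednK.
Qed.

End Blocks.

(** * The knapsack and the main theorem *)

Lemma sum_pow2 s : (\sum_(j < s) 2 ^ j)%N = (2 ^ s - 1)%N.
Proof. by rewrite subn1 predn_exp mul1n. Qed.

Section Knapsack.
Variables (k S : nat) (s : 'I_k -> nat) (last : 'I_k).
Hypotheses (s_le : forall i, (s i <= S)%N) (s_last : s last = S).
Local Notation item := ('I_k + 'I_S)%type.

Definition capacity := (2 ^ S.+1)%N.

(* A large item [inl i] leaves room for exactly the first [s i] of the small
   items, and two large items never fit together. *)
Definition item_weight (x : item) : nat :=
  match x with inl i => capacity - (2 ^ s i - 1) | inr j => 2 ^ j end.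

Definition packing (i : 'I_k) (x : item) : bool :=
  match x with inl i' => i' == i | inr j => (j < s i)%N end.

Let pow_s i : (0 < 2 ^ s i <= 2 ^ S)%N.
Proof. by rewrite expn_gt0 leq_exp2l ?s_le. Qed.

Lemma item_weight_gt0 x : (0 < item_weight x)%N.
Proof.
case: x => [i|j] /=; last by rewrite expn_gt0.
by have := pow_s i; rewrite /capacity expnS; lia.
Qed.

Lemma sum_packing i : (\sum_(x | packing i x) item_weight x)%N = capacity.
Proof.
rewrite big_sumType /= big_pred1_eq -(big_ord_widen S (fun j => 2 ^ j)%N (s_le i)).
by rewrite sum_pow2; have := pow_s i; rewrite /capacity expnS; lia.
Qed.

Lemma card_packing i : #|packing i| = (s i).+1.
Proof.
rewrite -sum1_card big_sumType /= big_pred1_eq.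
by rewrite -(big_ord_widen S (fun=> 1)%N (s_le i)) sum1_card card_ord.
Qed.

(** Two large items overflow, and so does [inl i] with a small [inr j] where [s i <= j], since
    [2 ^ j] exceeds the room [2 ^ s i - 1]. Sets without large items fit in the packing of [last],
    which has all [S] small items. *)
Lemma knapsack (T : pred item) :
  (\sum_(x | T x) item_weight x <= capacity)%N <->
  exists i, {subset T <= packing i}.
Proof.
split=> [TW|[i Ti]]; last first.
  rewrite -(sum_packing i) [X in (_ <= X)%N](bigID T) /=.
  apply: leq_trans (leq_addr _ _); rewrite [X in (X <= _)%N](bigID (packing i)) /=.
  rewrite [X in (_ + X)%N]big1 ?addn0.
    by rewrite (eq_bigl (fun x => packing i x && T x)) // => x; rewrite andbC.
  by move=> x /andP[/Ti]; rewrite /in_mem /= => ->.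
have two x y : T x -> T y -> x != y -> (item_weight x + item_weight y <= capacity)%N.
  move=> Tx Ty xy; apply: leq_trans TW; rewrite (bigD1 x) //= (bigD1 y) /=.
    by rewrite addnA leq_addr.
  by rewrite Ty eq_sym.
have [/existsP[i Ti]|/existsPn noL] := boolP [exists i, T (inl i)].
  exists i => -[i'|j] Tx; rewrite /in_mem /=.
    apply: contraT => ii'; have /= := two _ _ Ti Tx.
    have := pow_s i; have := pow_s i'; rewrite /capacity expnS.
    have -> : (inl i != inl i' :> item) by apply: contraNneq ii' => -[->].
    by move=> H1 H2 /(_ isT); lia.
  have /= := two _ _ Ti Tx isT; rewrite -(ltn_exp2l (m := 2)) //.
  by have := pow_s i; rewrite /capacity expnS; lia.
exists last => -[i|j] Tx; first by have := noL i; rewrite (Tx : T _).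
by rewrite /in_mem /= s_last.
Qed.

End Knapsack.

Lemma irreducible_coprime_sizes (F : fieldType) (f g : {poly F}) :
  irreducible_poly f -> irreducible_poly g -> size f != size g -> coprimep f g.
Proof.
move=> irrf [_ gP] fg; have [fdg|//] := irreducible_dvdp_or_coprime g irrf.
have f1 : size f != 1 by case: irrf => f1 _; rewrite neq_ltn f1 orbT.
by case/eqP: fg; apply/eqp_size/gP.
Qed.

(** * Prescribed lengths from a finite residue field *)

Section FiniteResidueField.
Variables (D : idomainType) (D_ufd : is_ufd D) (p : D) (p_prime : prime_elt p).
Variables (m : nat) (u : 'I_m -> D).
Hypotheses (m_gt0 : (0 < m)%N) (pu : forall c, ~ divides p (u c)).
Hypothesis class_inhabited : forall c, exists x, divides p (1 - u c * x).
Hypothesis class_uniq : forall x, ~ divides p x ->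
  exists c, forall c', divides p (1 - u c' * x) <-> c' = c.
Local Notation tofrac := (@FracField.tofrac D).
Local Notation "f ^K" := (map_poly tofrac f) (at level 2, format "f ^K").

Lemma class_notin c x : divides p (1 - u c * x) -> ~ divides p x.
Proof.
move=> ux px; have [_ /negP pNu _] := p_prime; apply: pNu.
apply: (divides_unit (unitr1 D)); rewrite -(subrK (u c * x) 1).
exact/divides_add/divides_mull.
Qed.

(** At [x] in class [c] the center block and the blocks of other classes have value 0, so the
    weights of class [c] add up to the value of the product. At multiples of [p] the center block
    alone supplies [p^N]. *)
Lemma blocks_divisible (J : finType) (cls : J -> 'I_m) (n w : J -> nat)
    (n0 N : nat) (I : {set J}) :
  (0 < N < n0)%N -> (forall j, (0 < w j < n j)%N) ->
  (forall x, divides (p ^+ N) ((center_block p n0 N).[x] *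
     \prod_(j in I) (shifted_block p (u (cls j)) (n j) (w j)).[x])) <->
  (forall c, (N <= \sum_(j in I | cls j == c) w j)%N).
Proof.
move=> /andP[N0 Nn0] wn.
have exP x : ~ divides p x -> exists c, divides p (1 - u c * x) /\
    exact_power p ((center_block p n0 N).[x] *
     \prod_(j in I) (shifted_block p (u (cls j)) (n j) (w j)).[x])
     (0 + \sum_(j in I) if cls j == c then w j else 0)%N.
  move=> px; have [c cP] := class_uniq px; exists c; split; first exact/cP.
  apply: exact_powerM => //; first exact: center_block_out.
  apply: exact_power_prod => // j _; have /andP[wj0 wjn] := wn j.
  case: eqP => [/cP ux|ucx]; first exact: shifted_block_in.
  by apply: shifted_block_out => // /cP.
split=> [dvd c|le x].
  have [x cx] := class_inhabited c; have px := class_notin cx.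
  have [c' [c'x]] := exP x px; have [c1 c1P] := class_uniq px.
  rewrite (_ : c' = c) ?add0n; last by rewrite (c1P c').1 // (c1P c).1.
  by rewrite -big_mkcondr => /exact_power_divides -/(_ p_prime N) <-.
have [px|/exP[c [_ ex]]] := pselect (divides p x).
  apply: divides_mulr; apply/(exact_power_divides p_prime); last by apply: leqnn.
  exact: center_block_in.
by apply/(exact_power_divides p_prime _ ex); rewrite add0n -big_mkcondr.
Qed.

Lemma finite_residue_full : full_system_of_multisets_of_lengths (Int D).
Proof.
move=> k n k_gt0 n_gt1 n_mono.
have last_lt : (k.-1 < k)%N by rewrite prednK.
(* The subtracted 2 accounts for the block carrying [Q0] and for the large item of the packing. *)
pose last := Ordinal last_lt; pose s i := (n i - 2)%N; pose S := s last.
have s_le i : (s i <= S)%N.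
  by apply: leq_sub2r; apply: n_mono; rewrite /= -ltnS prednK.
pose item : finType := ('I_k + 'I_S)%type.
(* One filler [inl c] for each class, besides the knapsack items, which all belong to class [c0]. *)
pose J : finType := ('I_m + item)%type.
pose om : item -> nat := item_weight s; pose W := capacity S.
pose c0 : 'I_m := Ordinal m_gt0.
(* All items together miss [N] by one, so each filler is compulsory. The filler of [c0] weighs
   [W.+1], which lets items of total weight up to [W] be left out. *)
pose N := (\sum_x om x).+1.
pose w (j : J) := match j with inl c => if c == c0 then W.+1 else N
  | inr x => om x end.
pose cls (j : J) := if j is inl c then c else c0.
have om_gt0 x : (0 < om x)%N by apply: item_weight_gt0.
have w_gt0 j : (0 < w j)%N by case: j => [c|x] //=; case: ifP.
(* A common multiple of [N] and all weights: degrees congruent to 1 modulo [L] are coprime to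
   them. *)
pose L := (N * \prod_j w j)%N.
have L_gt0 : (0 < L)%N by rewrite muln_gt0 /= prodn_gt0.
have wL j : (w j %| L)%N by rewrite /L (bigD1 j) //= mulnCA dvdn_mulr.
(* The rank makes the degrees distinct, and [.+2] keeps them away from the degree [L.+1] of [Q0]. *)
pose deg (j : J) := (L * (enum_rank j).+2).+1.
have w_deg j : (w j < deg j)%N.
  by rewrite ltnS (leq_trans (dvdn_leq L_gt0 (wL j))) // leq_pmulr.
have N_L : (N < L.+1)%N by rewrite ltnS leq_pmulr // prodn_gt0.
pose Q j := shifted_block p (u (cls j)) (deg j) (w j).
pose Q0 := center_block p L.+1 N.
have deg_gt1 j : (1 < deg j)%N by rewrite ltnS muln_gt0 L_gt0.
have uN0 c : u c != 0.
  by apply/eqP => u0; apply: (pu (c := c)); rewrite u0; apply: divides0.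
have irrQ j : irreducible_poly (Q j)^K.
  apply: shifted_block_irreducible => //.
  exact: coprime_dvdr (dvdn_mulr _ (wL j)) (coprimeSn _).
have irrQ0 : irreducible_poly Q0^K.
  apply: center_block_irreducible => //.
  exact: coprime_dvdr (dvdn_mulr _ (dvdnn N)) (coprimeSn _).
have sQ j : size (Q j)^K = (deg j).+1.
  by rewrite size_tofrac_poly size_shifted_block.
pose C (i : 'I_k) : {set J} :=
  [set j : J | if j is inr x then packing s i x else false]%SET.
have [] := @covers_factorizations D J k (p ^+ N) (- 1) Q0 Q C.
- by have [p0 _ _] := p_prime; rewrite expf_neq0.
- by rewrite unitrN unitr1.
- exact: k_gt0.
- exact: center_block0.
- by move=> j; apply: shifted_block0.
- exact: irrQ0.
- exact: irrQ.
- move=> j; apply: irreducible_coprime_sizes => //.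
  rewrite sQ size_tofrac_poly size_center_block // !eqSS /deg.
  by rewrite -[X in X != _]muln1 eqn_pmul2l.
- move=> i j ij; apply: irreducible_coprime_sizes => //.
  by rewrite !sQ !eqSS eqn_pmul2l // !eqSS (inj_eq val_inj) (inj_eq enum_rank_inj).
- move=> I; rewrite blocks_divisible ?N_L //; last by move=> j; rewrite w_gt0 w_deg.
  (* Once all fillers are in [I], only class [c0] leaves a condition: the items [T] split off weigh
     at most [W]. *)
  pose T (x : item) := inr x \notin I.
  apply: (@iff_trans _ ((forall c, inl c \in I) /\
    (\sum_(x | T x) om x <= W)%N)); last first.
    rewrite knapsack //; split=> [[cI [i Ti]]|[i Ii]].
      exists i; apply/fintype.subsetP => -[c|x]; rewrite !inE ?cI // => xI.
      exact: Ti.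
    split=> [c|]; last first.
      exists i => x Tx; have := fintype.subsetP Ii (inr x).
      by rewrite !inE; apply.
    apply: contraT => cI; have := fintype.subsetP Ii (inl c).
    by rewrite !inE cI => /(_ isT).
  have sumE c : (\sum_(j in I | cls j == c) w j =
      (if inl c \in I then w (inl c) else 0) +
      (if c == c0 then \sum_(x | inr x \in I) om x else 0))%N.
    rewrite big_sumType /=; congr (_ + _)%N.
      case: ifP => cI; [rewrite (big_pred1 c) // | rewrite big_pred0 //];
        by move=> c' /=; case: eqP => [->|_]; rewrite ?cI ?andbF.
    rewrite eq_sym; case: eqP => _; last by rewrite big_pred0 // => x; rewrite andbF.
    by apply: eq_bigl => x; rewrite andbT.
  have sumT : (\sum_x om x = \sum_(x | inr x \in I) om x + \sum_(x | T x) om x)%N.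
    by rewrite (bigID (fun x => inr x \in I)).
  split=> [H|[cI TW] c].
    have cI c : inl c \in I.
      apply: contraT => cI; have := H c; rewrite sumE (negPf cI) add0n.
      by rewrite leqNgt ltnS; case: ifP => // _; rewrite sumT leq_addr.
    split=> //; have := H c0; rewrite sumE cI /=.
    by rewrite /N sumT addSn ltnS addnC leq_add2r.
  rewrite sumE cI /=; case: ifP => [_|_]; last by rewrite addn0.
  by rewrite /N sumT addSn ltnS addnC leq_add2r.
- move=> i j /fintype.subsetP /(_ (inr (inl i))).
  by rewrite !inE /= eqxx => /(_ isT) /eqP.
move=> H [t [Ht st tN tall]]; exists H, t; split=> // i; rewrite st.
have -> : #|C i| = #|packing s i (S := S)|.
  rewrite -!sum1_card big_sumType /= big_pred0 ?add0n => [|c]; last by rewrite inE.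
  by apply: eq_bigl => x; rewrite inE.
by rewrite card_packing // /s; have := n_gt1 i; lia.
Qed.

End FiniteResidueField.

Theorem corollary5p4 (D : idomainType) (D_ufd : is_ufd D) :
  let Int_eq_ufd := Int_set D = polys_over_base D /\ is_ufd (Int D) in
  let Int_full := full_system_of_multisets_of_lengths (Int D) in
  ((Int_eq_ufd \/ Int_full) /\ ~ (Int_eq_ufd /\ Int_full)) /\
  (Int_eq_ufd <->
   forall P : prime_idealr D,
     has_height P 1%N -> infinite_set [set: residue_field P]).
Proof.
move=> Int_eq_ufd Int_full.
have excl : ~ (Int_eq_ufd /\ Int_full) by case=> -[_ ufd] /full_not_ufd.
have [inf|fin] := pselect (forall P : prime_idealr D,
    has_height P 1%N -> infinite_set [set: residue_field P]).
  suff eq_ufd : Int_eq_ufd by split; [split=> //; left | split].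
  have IntE : Int_set D = polys_over_base D.
    apply: Int_set_eq_base => // p q p_prime.
    apply: infinite_residue_vanish (inf (principal_ideal p_prime) _).
      by move=> x; split=> /principal_idealP.
    exact: principal_height_one.
  by split=> //; apply: Int_ufd.
suff full : Int_full.
  split; first by split=> //; right.
  by split=> [eq_ufd|//]; case: excl.
have [P /not_implyP[hP finP]] := (existsNP _).2 fin.
have [p p_prime PE] := height_one_principal D_ufd hP.
have [m [u [m0 pu inh uniq]]] := residue_representatives PE finP.
exact: finite_residue_full inh uniq.
Qed.
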